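(* Let $\Gamma$ be a non-empty finite connected graph, $\mathcal{L}(\Gamma)$ a labeled graph over $\Gamma$, $G$ the GBS-group defined by $\mathcal{L}(\Gamma)$, and $\Delta\colon G\to\mathbb{Q}^*$ its modular homomorphism (defined when $G$ is not elementary). The following statements are equivalent. 1. $G$ is residually finite. 2. $G$ is residually a finite solvable group. 3. Either $G$ is solvable, or $G$ is not solvable and $\operatorname{Im}\Delta\subseteq\{1,-1\}$.
   Context: For a class $\mathcal{C}$ of groups, a group $G$ is residually a $\mathcal{C}$-group if for every non-unit $g\in G$ there is a homomorphism $\sigma$ of $G$ onto a group of $\mathcal{C}$ with $g\sigma\neq 1$. $\mathrm{BS}(m,n)=\langle a,b;\ a^{-1}b^ma=b^n\rangle$ for non-zero integers $m,n$. Labeled graphs and GBS-groups. $\Gamma=(V,E)$ is a non-empty finite connected undirected graph (loops and multiple edges allowed). The ends of an edge $e$ are denoted $e(1),e(-1)$ (in a fixed order; they coincide if $e$ is a loop). A labeled graph $\mathcal{L}(\Gamma)$ is obtained by assigning to each $e\in E$ non-zero integers $\lambda(+e)$ (at $e(1)$) and $\lambda(-e)$ (at $e(-1)$), called labels. Fix a maximal subtree $T$ of $\Gamma$ with edge set $E_T$. The GBS-group defined by $\mathcal{L}(\Gamma)$ (the fundamental group of the corresponding graph of infinite cyclic groups) is the group $G=\pi_1(\mathcal{L}(\Gamma))$ with generators $g_v$ ($v\in V$), $t_e$ ($e\in E\setminus E_T$) and defining relations $g_{e(1)}^{\lambda(+e)}=g_{e(-1)}^{\lambda(-e)}$ ($e\in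 E_T$), $t_e^{-1}g_{e(1)}^{\lambda(+e)}t_e=g_{e(-1)}^{\lambda(-e)}$ ($e\in E\setminus E_T$); up to isomorphism it does not depend on $T$. The vertex groups are the subgroups $G_v=\langle g_v\rangle$, which are infinite cyclic. $G$ is elementary if it is isomorphic to $\mathbb{Z}$, $\mathrm{BS}(1,1)$ or $\mathrm{BS}(1,-1)$ (elementary groups are solvable). An element of $G$ is elliptic if it is conjugate to an element of some vertex group. Modular homomorphism. If $G$ is not elementary, $\Delta\colon G\to\mathbb{Q}^*$ is defined as follows: for $g\in G$ take any non-unit elliptic element $a$ and non-zero integers $m,n$ with $g^{-1}a^mg=a^n$ (they exist), and put $\Delta(g)=n/m$; this is a well-defined homomorphism independent of the choices. *)

(* Defs.v *)
From HB Require Import structures.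
From mathcomp Require Import all_boot all_order all_algebra.
From mathcomp Require Import boolp classical_sets cardinality.

Set Implicit Arguments.
Unset Strict Implicit.
Unset Printing Implicit Defensive.

Local Open Scope group_scope.
Local Open Scope quotient_scope.

(* Throughout, groups are MathComp's [groupType] (no finiteness assumed), and
   the letter [(x, true)] of a word stands for the generator [x], the letter
   [(x, false)] for its formal inverse. *)

Section Presentation.
Variables (X : choiceType) (R : seq (X * bool) -> seq (X * bool) -> Prop).
Implicit Types u v w : seq (X * bool).

Inductive pres_eq : seq (X * bool) -> seq (X * bool) -> Prop :=
| PresRel u v of R u v : pres_eq u v
| PresCancel x b : pres_eq [:: (x, b); (x, ~~ b)] [::]
| PresRefl u : pres_eq u u
| PresSym u v of pres_eq u v : pres_eq v u
| PresTrans v u w of pres_eq u v & pres_eq v w : pres_eq u w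
| PresCat u u' v v' of pres_eq u u' & pres_eq v v' : pres_eq (u ++ v) (u' ++ v').

Definition pres_eqb u v := `[< pres_eq u v >].

Lemma pres_eqb_refl : reflexive pres_eqb.
Proof. by move=> u; apply/asboolP/PresRefl. Qed.

Lemma pres_eqb_sym : symmetric pres_eqb.
Proof. by move=> u v; apply/asboolP/asboolP; apply: PresSym. Qed.

Lemma pres_eqb_trans : transitive pres_eqb.
Proof.
by move=> v u w /asboolP uv /asboolP vw; apply/asboolP/(PresTrans uv vw).
Qed.

Canonical pres_equiv :=
  EquivRel pres_eqb pres_eqb_refl pres_eqb_sym pres_eqb_trans.

(* The group with generators [X] and defining relations [u = v] for [R u v]. *)
Definition presented := {eq_quot pres_equiv}.
HB.instance Definition _ := Choice.on presented.
HB.instance Definition _ := EqQuotient.on presented.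

Definition winv w := rev [seq (l.1, ~~ l.2) | l <- w].

Definition word_class w : presented := \pi w.

Lemma word_class_eqP u v : word_class u = word_class v <-> pres_eq u v.
Proof.
rewrite /word_class; split=> [/eqP|uv]; first by rewrite eqmodE => /asboolP.
by apply/eqP; rewrite eqmodE; apply/asboolP.
Qed.

Definition pres_one : presented := word_class [::].
Definition pres_mul (g h : presented) : presented :=
  word_class (repr g ++ repr h).
Definition pres_inv (g : presented) : presented := word_class (winv (repr g)).

Lemma winvK : involutive winv.
Proof.
move=> w; rewrite /winv map_rev revK -map_comp -[RHS]map_id.
by apply: eq_map => -[x b] /=; rewrite negbK.
Qed.

Lemma winv_cat u v : winv (u ++ v) = winv v ++ winv u.
Proof. by rewrite /winv map_cat rev_cat. Qed.

Lemma pres_eq_winvr w : pres_eq (w ++ winv w) [::].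
Proof.
elim: w => [|[x b] w IHw]; first exact: PresRefl.
rewrite -cat1s winv_cat -catA [w ++ _]catA.
apply: PresTrans (PresCancel x b).
rewrite -[X in pres_eq _ X]/([:: (x, b)] ++ [::] ++ [:: (x, ~~ b)]).
apply: PresCat; first exact: PresRefl.
by apply: PresCat => //; apply: PresRefl.
Qed.

Lemma pres_eq_winvl w : pres_eq (winv w ++ w) [::].
Proof. by rewrite -{2}[w]winvK; apply: pres_eq_winvr. Qed.

Lemma pres_eq_winv u v : pres_eq u v -> pres_eq (winv u) (winv v).
Proof.
move=> uv; apply: (@PresTrans (winv u ++ (v ++ winv v))).
  rewrite -{1}[winv u]cats0; apply: PresCat; first exact: PresRefl.
  exact/PresSym/pres_eq_winvr.
rewrite catA -[winv v in X in pres_eq _ X]cat0s.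
apply: PresCat; last exact: PresRefl.
apply: PresTrans (pres_eq_winvl u).
by apply: PresCat; [apply: PresRefl | apply: PresSym].
Qed.

Lemma repr_word_class w : pres_eq (repr (word_class w)) w.
Proof. by apply/word_class_eqP; rewrite /word_class reprK. Qed.

Lemma word_class_repr g : word_class (repr g) = g.
Proof. exact: reprK. Qed.

Lemma pres_mulE u v :
  pres_mul (word_class u) (word_class v) = word_class (u ++ v).
Proof. by apply/word_class_eqP/PresCat; apply: repr_word_class. Qed.

Lemma pres_invE w : pres_inv (word_class w) = word_class (winv w).
Proof. exact/word_class_eqP/pres_eq_winv/repr_word_class. Qed.

Lemma pres_mulA : associative pres_mul.
Proof.
move=> f g h; rewrite -(word_class_repr f) -(word_class_repr g).
by rewrite -(word_class_repr h) !pres_mulE catA.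
Qed.

Lemma pres_mul1g : left_id pres_one pres_mul.
Proof. by move=> g; rewrite -(word_class_repr g) pres_mulE. Qed.

Lemma pres_mulg1 : right_id pres_one pres_mul.
Proof. by move=> g; rewrite -(word_class_repr g) pres_mulE cats0. Qed.

Lemma pres_mulVg : left_inverse pres_one pres_inv pres_mul.
Proof.
move=> g; rewrite -(word_class_repr g) pres_invE pres_mulE.
exact/word_class_eqP/pres_eq_winvl.
Qed.

Lemma pres_mulgV : right_inverse pres_one pres_inv pres_mul.
Proof.
move=> g; rewrite -(word_class_repr g) pres_invE pres_mulE.
exact/word_class_eqP/pres_eq_winvr.
Qed.

HB.instance Definition _ := isGroup.Build presented
  pres_mulA pres_mul1g pres_mulg1 pres_mulVg pres_mulgV.

Definition pres_gen (x : X) : presented := word_class [:: (x, true)].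

End Presentation.

Section AbstractGroups.
Local Open Scope classical_set_scope.

Definition gexpz (G : groupType) (x : G) (k : int) : G :=
  match k with Posz n => x ^+ n | Negz n => x ^- n.+1 end.

Definition is_subgroup (G : groupType) (A : set G) : Prop :=
  A 1 /\ forall x y, A x -> A y -> A (x * y^-1).

Definition generated_subgroup (G : groupType) (A : set G) : set G :=
  smallest (@is_subgroup G) A.

Definition commutator_subgroup (G : groupType) (A : set G) : set G :=
  generated_subgroup [set [~ x, y] | x in A & y in A].

Definition derived_series (G : groupType) (n : nat) : set G :=
  iter n (@commutator_subgroup G) setT.

(* MathComp's [solvable] is restricted to subgroups of finite groups. *)
Definition solvable_group (G : groupType) : Prop :=
  exists n, derived_series n = [set (1 : G)].

Definition finite_group (G : groupType) : Prop := finite_set [set: G].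

Definition residually (C : groupType -> Prop) (G : groupType) : Prop :=
  forall g : G, g <> 1 ->
  exists (H : groupType) (f : {multiplicative G -> H}),
    [/\ C H, forall y, exists x, f x = y & f g <> 1].

Definition residually_finite (G : groupType) : Prop :=
  residually finite_group G.

Definition residually_finite_solvable (G : groupType) : Prop :=
  residually (fun H => finite_group H /\ solvable_group H) G.

End AbstractGroups.

(* Finite undirected multigraphs; the ends e(1) and e(-1) of an edge [e] are
   [endpt true e] and [endpt false e].  Likewise, for a labeling
   [lam : bool -> edge Gamma -> int], the labels of [e] at e(1) and e(-1) are
   [lam true e] and [lam false e]. *)
Record graph := Graph {
  vertex : finType;
  edge : finType;
  endpt : bool -> edge -> vertex
}.

Section Graphs.
Variable Gamma : graph.
Implicit Types (W : {set vertex Gamma}) (F : {set edge Gamma}).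

Definition adjacent F : rel (vertex Gamma) := fun u v =>
  [exists e in F, [exists s, (endpt s e == u) && (endpt (~~ s) e == v)]].

Definition connected_on W F : Prop := {in W &, forall u v, connect (adjacent F) u v}.

(* An oriented edge is a pair [(s, e)], going from [endpt s e] to
   [endpt (~~ s) e]. A circuit is a non-empty closed path with pairwise
   distinct edges and pairwise distinct vertices; loops and pairs of parallel
   edges are circuits. *)
Definition circuit (c : seq (bool * edge Gamma)) : bool :=
  [&& c != [::],
      cycle [rel d d' | endpt (~~ d.1) d.2 == endpt d'.1 d'.2] c,
      uniq [seq d.2 | d <- c] & uniq [seq endpt d.1 d.2 | d <- c]].

Definition subtree W F : Prop :=
  [/\ exists v, v \in W,
      forall e, e \in F -> forall s, endpt s e \in W,
      connected_on W F
    & forall c, circuit c -> exists2 d, d \in c & d.2 \notin F].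

Definition maximal_subtree W F : Prop :=
  subtree W F /\
  forall W' F', subtree W' F' -> W \subset W' -> F \subset F' ->
    W' = W /\ F' = F.

End Graphs.

Definition connected_graph (Gamma : graph) : Prop :=
  forall u v : vertex Gamma, connect (adjacent [set: edge Gamma]) u v.

Section GBS.
Variables (Gamma : graph) (lam : bool -> edge Gamma -> int).
Variable ET : {set edge Gamma}.

Definition gbs_gen : choiceType := (vertex Gamma + {e | e \notin ET})%type.

Definition vertex_word (v : vertex Gamma) (k : int) : seq (gbs_gen * bool) :=
  match k with
  | Posz n => nseq n (inl v, true)
  | Negz n => nseq n.+1 (inl v, false)
  end.

Definition edge_word (s : bool) (e : edge Gamma) : seq (gbs_gen * bool) :=
  vertex_word (endpt s e) (lam s e).

Inductive gbs_rel : seq (gbs_gen * bool) -> seq (gbs_gen * bool) -> Prop :=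
| GBSTree e of e \in ET : gbs_rel (edge_word true e) (edge_word false e)
| GBSStable (t : {e | e \notin ET}) :
    gbs_rel ((inr t, false) :: edge_word true (val t) ++ [:: (inr t, true)])
            (edge_word false (val t)).

Definition gbs_group : groupType := presented gbs_rel.

Definition gbs_vertex (v : vertex Gamma) : gbs_group :=
  pres_gen gbs_rel (inl v).

Definition vertex_group (v : vertex Gamma) : set gbs_group :=
  generated_subgroup [set gbs_vertex v]%classic.

Definition elliptic (a : gbs_group) : Prop :=
  exists v x h, vertex_group v x /\ a = x ^ h.

Definition modular_value (g : gbs_group) (q : rat) : Prop :=
  exists (a : gbs_group) (m n : int),
    [/\ elliptic a /\ a <> 1, m != 0%R, n != 0%R, gexpz a m ^ g = gexpz a n
      & q = (n%:Q / m%:Q)%R].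

(* The modular homomorphism, defined when the group is not elementary: every
   element then has exactly one modular value (a non-zero rational), so the
   choice made here is irrelevant and the default 0 is not used. Nothing is
   meant by [Delta] for elementary groups. *)
Definition Delta (g : gbs_group) : rat := xget 0%R (modular_value g).

End GBS.

(* Main.v *)
Require Import Defs.
From HB Require Import structures.
From mathcomp Require Import all_boot all_order all_algebra.
From mathcomp Require Import boolp classical_sets cardinality.
From mathcomp Require Import functions ring zify.

(* A representation of the labeled graph in a group [K] sends every vertex and
   every edge to an element of [K] so that the edge relations hold; a potential on
   the maximal tree turns it into a homomorphism from the GBS-group [G].  Mapping
   each vertex to the translation by 1 and each edge [e] to the dilation by
   lambda(+e)/lambda(-e) gives Phi : G -> Q ><| Q^*, injective on vertex groups,
   whose linear part is the inverse of Delta.  Reduction modulo large primes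
   separates the elements outside ker Phi in finite metabelian groups.

   From a representation in [K] and a finite-support function on the edges of the
   corresponding [K]-cover of the graph one obtains a representation in [C wr K]
   whose base component counts the crossings of a path with these edges.  If the
   representation is injective modulo the labels, finitely many such steps send a
   given reduced path of positive length outside the vertex group of its origin.
   When Im Delta is contained in {1, -1}, the translation parts can be made
   integral and reduced modulo a suitable M, so the process starts from a finite
   solvable group and stays among finite solvable groups: G is residually finite
   solvable.

   If some Delta(t) is not 1 or -1 and G is residually finite or solvable, then
   ker Phi is trivial, so G embeds in Q ><| Q^*.  Suppose alpha <> 1 in ker Phi
   and climb the wreath tower, starting from Q ><| Q^*, until alpha is a nonzero
   1-cycle of some cover.  The conjugates c_k of a power of a vertex generator by
   t^k have translation parts with unbounded denominators, so some c_k moves the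
   cycle off any given edge.  If G is residually finite, a suitable c_k is a power
   of c_0 in every finite quotient and commutes with alpha, which keeps the cycle
   invariant.  If G is solvable, alpha may be taken in an abelian normal subgroup,
   so alpha commutes with alpha' = alpha^c_k; but in the infinite cyclic cover cut
   along an edge crossed by alpha and not by alpha', alpha shifts the sheets, so
   the finitely supported cycle of alpha' is shift-invariant, hence zero. *)

Set Implicit Arguments.
Unset Strict Implicit.
Unset Printing Implicit Defensive.

Import Order.TTheory GRing.Theory Num.Theory.

Local Open Scope group_scope.

(** * Groups, semidirect and wreath products *)

Section GroupMorphisms.
Variables (G H : groupType) (f : G -> H).
Hypothesis fM : {morph f : x y / x * y}.

Lemma morph_g1 : f 1 = 1.
Proof. by apply: (mulgI (f 1)); rewrite -fM !mulg1. Qed.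

Lemma morph_gV x : f x^-1 = (f x)^-1.
Proof. by apply: (mulgI (f x)); rewrite -fM !mulgV morph_g1. Qed.

Lemma morph_gX x n : f (x ^+ n) = f x ^+ n.
Proof. by elim: n => [|n IH]; rewrite ?morph_g1// !expgS fM IH. Qed.

Lemma morph_gJ x y : f (x ^ y) = f x ^ f y.
Proof. by rewrite !conjgE !fM morph_gV. Qed.

Lemma morph_gR x y : f [~ x, y] = [~ f x, f y].
Proof. by rewrite !commgEl fM morph_gJ morph_gV. Qed.

Lemma morph_gexpz x k : f (gexpz x k) = gexpz (f x) k.
Proof. by case: k => n /=; rewrite ?morph_gV morph_gX. Qed.

End GroupMorphisms.

Section IntegerPowers.
Variable G : groupType.
Implicit Types (x y : G) (m n k : int).

Lemma gexpz0 x : gexpz x 0 = 1. Proof. by []. Qed.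

Lemma gexpz1 x : gexpz x 1 = x. Proof. by []. Qed.

Lemma gexpzN x k : gexpz x (- k) = (gexpz x k)^-1.
Proof.
case: k => [[|n]|n] //=; first by rewrite invg1.
by rewrite invgK.
Qed.

Lemma gexpzS x k : gexpz x (k + 1) = gexpz x k * x.
Proof.
case: k => n.
  by rewrite -PoszD /= expgnDr.
rewrite NegzE -addn1 PoszD opprD -addrA addNr addr0.
by rewrite -opprD !gexpzN -PoszD /= addn1 expgS invgM mulgVK.
Qed.

Lemma gexpzD x m n : gexpz x (m + n) = gexpz x m * gexpz x n.
Proof.
elim/int_ind: n => [|n IH|n IH]; first by rewrite addr0 mulg1.
  by rewrite -addn1 PoszD addrA gexpzS IH gexpzS mulgA.
apply: (mulIg x); rewrite -mulgA -!gexpzS -addn1 PoszD opprD.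
by rewrite !addrA !addrNK IH.
Qed.

Lemma gexpzB x m n : gexpz x (m - n) = gexpz x m * (gexpz x n)^-1.
Proof. by rewrite gexpzD gexpzN. Qed.

Lemma gexpzM x m n : gexpz x (m * n) = gexpz (gexpz x m) n.
Proof.
elim/int_ind: n => [|n IH|n IH]; first by rewrite mulr0.
  by rewrite -addn1 PoszD mulrDr mulr1 !gexpzD IH.
rewrite -addn1 PoszD opprD mulrDr mulrN1 !gexpzD IH.
by rewrite !gexpzN.
Qed.

Lemma gexpzJ x y k : gexpz (x ^ y) k = gexpz x k ^ y.
Proof. by case: k => n; rewrite /gexpz ?conjVg conjXg. Qed.

Lemma gexpz_commute x y k : commute x y -> commute x (gexpz y k).
Proof. by case: k => n xy; [apply/commuteX | apply/commuteV/commuteX]. Qed.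

Lemma gexpz_conj x y k : gexpz (y * x * y^-1) k = y * gexpz x k * y^-1.
Proof.
have e z : y * z * y^-1 = z ^ y^-1 by rewrite conjgE invgK mulgA.
by rewrite !e gexpzJ.
Qed.

Lemma gexpz_comm x m n : gexpz x m * gexpz x n = gexpz x n * gexpz x m.
Proof. by rewrite -!gexpzD addrC. Qed.

End IntegerPowers.

Record group_action (K : groupType) (N : zmodType) := GroupAction {
  act : K -> N -> N;
  actD : forall k, {morph act k : x y / (x + y)%R};
  act1 : forall n, act 1 n = n;
  actM : forall k l n, act (k * l) n = act k (act l n)
}.

(** The action is a phantom argument of the pair type, so that each action carries its own group
    structure. *)
Definition semidirect (K : groupType) (N : zmodType) of group_action K N : Type :=
  (N * K)%type.

Section Semidirect.
Variables (K : groupType) (N : zmodType) (A : group_action K N).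

Local Notation semidirect := (semidirect A).
HB.instance Definition _ := Choice.copy semidirect (N * K)%type.
Implicit Types x y : semidirect.

Definition sd_mul x y : semidirect := ((x.1 + act A x.2 y.1)%R, x.2 * y.2).
Definition sd_one : semidirect := (0%R, 1).
Definition sd_inv x : semidirect := ((- act A x.2^-1 x.1)%R, x.2^-1).

Lemma act0 k : act A k 0%R = 0%R.
Proof. by apply: (addrI (act A k 0%R)); rewrite -actD !addr0. Qed.

Lemma actN k n : act A k (- n)%R = (- act A k n)%R.
Proof. by apply: (addrI (act A k n)); rewrite -actD !addrN act0. Qed.

Lemma sd_mulA : associative sd_mul.
Proof. by move=> x y z; rewrite /sd_mul /= actD actM addrA mulgA. Qed.
Lemma sd_mul1g : left_id sd_one sd_mul.
Proof. by case=> n k; rewrite /sd_mul /= act1 add0r mul1g. Qed.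
Lemma sd_mulg1 : right_id sd_one sd_mul.
Proof. by case=> n k; rewrite /sd_mul /= act0 addr0 mulg1. Qed.
Lemma sd_mulVg : left_inverse sd_one sd_inv sd_mul.
Proof. by case=> n k; rewrite /sd_mul /= addNr mulVg. Qed.
Lemma sd_mulgV : right_inverse sd_one sd_inv sd_mul.
Proof. by case=> n k; rewrite /sd_mul /= actN -actM mulgV act1 addrN. Qed.

HB.instance Definition _ := isGroup.Build semidirect
  sd_mulA sd_mul1g sd_mulg1 sd_mulVg sd_mulgV.

Lemma sd_mulE x y : x * y = ((x.1 + act A x.2 y.1)%R, x.2 * y.2).
Proof. by []. Qed.

Lemma sd_invE x : x^-1 = ((- act A x.2^-1 x.1)%R, x.2^-1).
Proof. by []. Qed.

Lemma sd_snd : {morph (fun x : semidirect => x.2) : x y / x * y}.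
Proof. by []. Qed.

Lemma sd_gexpz0 (k : K) j : gexpz ((0%R, k) : semidirect) j = (0%R, gexpz k j).
Proof.
have X n : (((0%R, k) : semidirect) ^+ n).1 = 0%R.
  by elim: n => [|n IH] //; rewrite expgS sd_mulE /= IH act0 addr0.
have g1 : (gexpz ((0%R, k) : semidirect) j).1 = 0%R.
  by case: j => n; rewrite /gexpz ?sd_invE/= X ?act0 ?oppr0.
have g2 := morph_gexpz sd_snd ((0%R, k) : semidirect) j.
by case: (gexpz _ j) g1 g2 => n l /= -> ->.
Qed.

Lemma sd_gexpz1 (n : N) j :
  gexpz ((n, 1) : semidirect) j = ((n *~ j)%R, 1).
Proof.
have X i : ((n, 1) : semidirect) ^+ i = ((n *+ i)%R, 1).
  by elim: i => [|i IH] //; rewrite expgS IH sd_mulE /= act1 mulrS mulg1.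
case: j => i; rewrite /gexpz X //.
by rewrite sd_invE /= invg1 act1 NegzE mulrNz.
Qed.

End Semidirect.

Section Units.
Variable R : comUnitRingType.

Definition units := {u : R | u \is a GRing.unit}.
HB.instance Definition _ := Choice.on units.
Implicit Types u v : units.

Lemma units_mulP u v : (val u * val v)%R \is a @GRing.unit R.
Proof. by rewrite unitrMl; [apply: (valP u) | apply: (valP v)]. Qed.
Lemma units_invP u : (val u)^-1%R \is a @GRing.unit R.
Proof. by rewrite unitrV; apply: (valP u). Qed.

Definition units_mul u v : units :=
  exist (fun u : R => u \is a GRing.unit) _ (units_mulP u v).
Definition units_inv u : units :=
  exist (fun u : R => u \is a GRing.unit) _ (units_invP u).
Definition units_one : units := exist (fun u : R => u \is a GRing.unit) _ (@unitr1 R).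

Lemma units_mulA : associative units_mul.
Proof. by move=> u v w; apply/val_inj; rewrite /= mulrA. Qed.
Lemma units_mul1g : left_id units_one units_mul.
Proof. by move=> u; apply/val_inj; rewrite /= mul1r. Qed.
Lemma units_mulg1 : right_id units_one units_mul.
Proof. by move=> u; apply/val_inj; rewrite /= mulr1. Qed.
Lemma units_mulVg : left_inverse units_one units_inv units_mul.
Proof. by move=> u; apply/val_inj; rewrite /= mulVr //; apply: (valP u). Qed.
Lemma units_mulgV : right_inverse units_one units_inv units_mul.
Proof. by move=> u; apply/val_inj; rewrite /= divrr //; apply: (valP u). Qed.

HB.instance Definition _ := isGroup.Build units
  units_mulA units_mul1g units_mulg1 units_mulVg units_mulgV.

Lemma units_mulC u v : u * v = v * u.
Proof. by apply/val_inj; rewrite /= mulrC. Qed.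

Definition units_action : group_action units R.
Proof.
refine (@GroupAction units R (fun u x => val u * x)%R _ _ _).
- by move=> u x y /=; rewrite mulrDr.
- by move=> x /=; rewrite mul1r.
- by move=> u v x /=; rewrite mulrA.
Defined.

(** The pair [(x, u)] is the map sending [y] to [x + u * y]; the product is composition. *)
Definition affine : groupType := semidirect units_action.

Lemma affine_mulE (x y : affine) : x * y = ((x.1 + val x.2 * y.1)%R, x.2 * y.2).
Proof. by []. Qed.

End Units.

Section Wreath.
Variables (K : groupType) (C : zmodType).

(** All functions are allowed: the wreath product is unrestricted. Since [K] acts by right
    translation, in a product the second factor is read at the point to which the first one moves
    [z]. *)
Definition wreath_action : group_action K (K -> C).
Proof.
refine (@GroupAction K (K -> C) (fun k F z => F (z * k)) _ _ _).
- by [].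
- by move=> F; apply/funext => z /=; rewrite mulg1.
- by move=> k l F; apply/funext => z /=; rewrite mulgA.
Defined.

Definition wreath : groupType := semidirect wreath_action.

Lemma wreath_fstM (x y : wreath) z : (x * y).1 z = (x.1 z + y.1 (z * x.2)%g)%R.
Proof. by []. Qed.

Lemma wreath_fstV (x : wreath) z : (x^-1).1 z = (- x.1 (z * x.2^-1)%g)%R.
Proof. by []. Qed.

End Wreath.

(** * Solvability and finiteness *)

Section DerivedSeries.
Local Open Scope classical_set_scope.
Implicit Types G H K : groupType.

Lemma generated_subgroupP G (A : set G) : is_subgroup (generated_subgroup A).
Proof.
split=> [B [[B1 _] _] //|x y xA yA B BA].
by apply: BA.1.2; [apply: xA | apply: yA].
Qed.

Lemma subgroupV G (A : set G) x : is_subgroup A -> A x -> A x^-1.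
Proof. by move=> [A1 AV] Ax; rewrite -div1g; apply: AV. Qed.

Lemma subgroupM G (A : set G) x y : is_subgroup A -> A x -> A y -> A (x * y).
Proof.
by move=> sA Ax Ay; rewrite -[y]invgK; apply: sA.2 => //; apply: subgroupV.
Qed.

Lemma derived_series_subgroup G n : is_subgroup (@derived_series G n).
Proof. by case: n => [//|n]; apply: generated_subgroupP. Qed.

Lemma derived_seriesR G n (x y : G) :
  derived_series n x -> derived_series n y -> derived_series n.+1 [~ x, y].
Proof. by move=> xn yn; apply: sub_gen_smallest; exists x => //; exists y. Qed.

Lemma derived_series_ind G n (B : set G) : is_subgroup B ->
  (forall x y, derived_series n x -> derived_series n y -> B [~ x, y]) ->
  @derived_series G n.+1 `<=` B.
Proof. by move=> sB RB; apply: smallest_sub => // _ [x nx [y ny <-]]; apply: RB. Qed.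

Lemma morph_derived_series G H (f : G -> H) n x :
  {morph f : x y / x * y} -> derived_series n x -> derived_series n (f x).
Proof.
move=> fM; elim: n x => // n IH; apply: derived_series_ind.
  have [h1 hV] := derived_series_subgroup H n.+1.
  split=> [|x y xB yB]; rewrite ?(morph_g1 fM)// fM (morph_gV fM).
  exact: hV.
by move=> x y xn yn; rewrite (morph_gR fM); apply: derived_seriesR; apply: IH.
Qed.

Lemma derived_series1 G n : @derived_series G n 1.
Proof. by case: (derived_series_subgroup G n). Qed.

Lemma solvable_groupP G :
  solvable_group G <-> exists n, forall x : G, derived_series n x -> x = 1.
Proof.
split=> -[n nG]; exists n; first by move=> x; rewrite nG.
by apply/seteqP; split=> // x ->; apply: derived_series1.
Qed.

Lemma solvable_inj G H (f : G -> H) : {morph f : x y / x * y} ->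
  (forall x, f x = 1 -> x = 1) -> solvable_group H -> solvable_group G.
Proof.
move=> fM f1 /solvable_groupP[n nH]; apply/solvable_groupP; exists n => x nx.
by apply/f1/nH/morph_derived_series.
Qed.

Lemma abelian_solvable G : (forall x y : G, x * y = y * x) -> solvable_group G.
Proof.
move=> mulgC; apply/solvable_groupP; exists 1%N.
have s1 : is_subgroup [set (1 : G)] by split=> // x y -> ->; rewrite invg1 mulg1.
by apply: (derived_series_ind s1) => x y _ _; apply/eqP/commgP/mulgC.
Qed.

(** The [n]-th derived subgroup dies in [K], hence lies in the abelian kernel, and one more
    commutator kills it. *)
Lemma semidirect_solvable K N (A : group_action K N) :
  solvable_group K -> solvable_group (semidirect A).
Proof.
move=> /solvable_groupP[n nK]; apply/solvable_groupP; exists n.+1.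
have s1 : is_subgroup [set (1 : semidirect A)].
  by split=> // x y -> ->; rewrite invg1 mulg1.
apply: (derived_series_ind s1) => x y.
move=> /(morph_derived_series (@sd_snd _ _ A)) /nK x2.
move=> /(morph_derived_series (@sd_snd _ _ A)) /nK y2.
apply/eqP/commgP; rewrite /commute !sd_mulE x2 y2 !act1.
by congr (_, _); rewrite addrC.
Qed.

Lemma affine_solvable (R : comUnitRingType) : solvable_group (affine R).
Proof. exact/semidirect_solvable/abelian_solvable/units_mulC. Qed.

End DerivedSeries.

Section Finiteness.
Local Open Scope classical_set_scope.

Lemma inj_finite T U (f : T -> U) : injective f ->
  finite_set [set: U] -> finite_set [set: T].
Proof.
move=> fI; apply: card_le_finite.
have /injfunPex[g] : exists2 g : T -> U, set_fun setT setT g & set_inj setT g.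
  by exists f => // x y _ _ /fI.
exact: inj_card_le.
Qed.

Lemma finite_fun (K : groupType) (C : finType) :
  finite_set [set: K] -> finite_set [set: K -> C].
Proof.
move=> /finite_set_leP[n] /pcard_leP[f].
have fn x : (f x < n)%N by have := @funS _ _ _ _ f x I.
(* Indices outside the image of [f] read [F] at the default 1; injectivity uses only those in the
   image. *)
pose h (F : K -> C) := [ffun i : 'I_n => F (xget 1 [set x | f x = i :> nat])].
apply: (@inj_finite _ _ h); last exact: finite_finset.
move=> F H /ffunP FH; apply/funext => x; have := FH (Ordinal (fn x)).
rewrite !ffunE /=; case: xgetP => [y _ /= fy|/(_ x)/(_ erefl)//].
by rewrite (_ : y = x) //; apply: (@inj _ _ _ f) => //; rewrite inE.
Qed.

Lemma wreath_finite (K : groupType) p :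
  finite_set [set: K] -> finite_set [set: wreath K 'F_p].
Proof.
move=> fK; apply: (@inj_finite _ ((K -> 'F_p) * K)%type id) => //.
rewrite -setXTT; apply: finite_setX => //; exact: finite_fun.
Qed.

Lemma affine_finite (R : finComUnitRingType) : finite_set [set: affine R].
Proof.
apply: (@inj_finite _ (R * R)%type (fun x => (x.1, val x.2))).
  by move=> [x u] [y v] [-> /val_inj ->].
exact: finite_finset.
Qed.

Lemma finite_order (K : groupType) (x : K) : finite_set [set: K] ->
  exists2 n, (0 < n)%N & x ^+ n = 1.
Proof.
move=> fK; apply: contrapT => noord; apply: infinite_nat.
apply: (@inj_finite _ K (fun n => x ^+ n)) => // m n.
wlog mn : m n / (m <= n)%N => [W|emn].
  by case: (leqP m n) => [|/ltnW] mn // /esym e; [apply/W/esym | apply/esym/W].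
apply/eqP; rewrite eqn_leq mn leqNgt /=; apply/negP => lt_mn.
apply: noord; exists (n - m)%N; first by rewrite subn_gt0.
by rewrite expgnFr // -emn mulgV.
Qed.

End Finiteness.

Section Image.
Variables (G K : groupType) (f : {multiplicative G -> K}).

Let fM : {morph f : x y / x * y}. Proof. exact: gmulfM. Qed.

Definition in_image : pred K := fun y => `[< exists x, f x = y >].

Lemma image_closed : group_closed in_image.
Proof.
split=> [|y z /asboolP[x <-] /asboolP[x' <-]]; apply/asboolP.
  by exists 1; exact: morph_g1 fM.
by exists (x / x'); rewrite fM (morph_gV fM).
Qed.

Definition image_group := {y | in_image y}.
HB.instance Definition _ := SubChoice.on image_group.
HB.instance Definition _ :=
  SubChoice_isSubGroup.Build K in_image image_group image_closed.

Definition to_image (x : G) : image_group :=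
  exist (fun y => in_image y) (f x) (asboolT (ex_intro _ x erefl)).

Lemma to_imageM : {morph to_image : x y / x * y}.
Proof. by move=> x y; apply/val_inj; rewrite /= gmulfM. Qed.

HB.instance Definition _ := isMultiplicative.Build G image_group to_image to_imageM.

End Image.

(** Surjectivity comes from restricting the codomain to the image, which stays finite and
    solvable. *)
Lemma residually_finite_solvableP (G : groupType) :
  (forall g : G, g <> 1 -> exists (K : groupType) (f : G -> K),
     [/\ {morph f : x y / x * y}, finite_set [set: K]%classic,
         solvable_group K & f g <> 1]) ->
  residually_finite_solvable G.
Proof.
move=> sep g /sep[K [f [fM fK sK fg]]].
pose fM' := isMultiplicative.Build G K f fM.
pose F : {multiplicative G -> K} := HB.pack f fM'.
exists (image_group F), (to_image F); split.
- split; first by apply: (@inj_finite _ K val) => //; apply: val_inj.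
  apply: (@solvable_inj _ K val) => // x x1; exact/val_inj.
- by move=> [y Sy]; have /asboolP[x xy] := Sy; exists x; apply/val_inj.
- by move=> /(congr1 val).
Qed.

(** * Presented groups and trees *)

Section PresentedLift.
Variables (X : choiceType) (R : seq (X * bool) -> seq (X * bool) -> Prop).
Variables (K : groupType) (h : X -> K).

Definition word_eval (w : seq (X * bool)) : K :=
  foldr (fun l y => (if l.2 then h l.1 else (h l.1)^-1) * y) 1 w.

Lemma word_eval_cat u v : word_eval (u ++ v) = word_eval u * word_eval v.
Proof. by elim: u => [|l u IH]; rewrite ?mul1g //= IH mulgA. Qed.

Lemma presented_lift :
  (forall u v, R u v -> word_eval u = word_eval v) ->
  exists f : presented R -> K,
    {morph f : x y / x * y} /\ forall x, f (pres_gen R x) = h x.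
Proof.
move=> RE.
have E u v : pres_eq R u v -> word_eval u = word_eval v.
  elim=> {u v} [u v /RE //|x b|u //|u v _ -> //|u v w _ -> _ -> //|].
    by case: b; rewrite /= mulg1 ?mulgV ?mulVg.
  by move=> u u' v v' _ uu' _ vv'; rewrite !word_eval_cat uu' vv'.
have fE w : word_eval (repr (word_class R w)) = word_eval w.
  exact/E/repr_word_class.
exists (fun g => word_eval (repr g)); split=> [g g'|x]; last first.
  by rewrite fE /= mulg1.
by rewrite -[g * g']/(pres_mul g g') fE word_eval_cat.
Qed.

End PresentedLift.

Lemma presented_ind (X : choiceType) R (B : set (presented R)) :
  is_subgroup B -> (forall x : X, B (pres_gen R x)) -> forall g, B g.
Proof.
move=> sB genB g; rewrite -(word_class_repr g).
elim: (repr g) => [|[x b] w IH]; first exact: sB.1.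
rewrite -cat1s -pres_mulE; apply: (subgroupM sB) => //.
case: b; first exact: genB.
rewrite (_ : word_class _ _ = (pres_gen R x)^-1); first exact: subgroupV.
exact: (esym (pres_invE R [:: (x, true)])).
Qed.

Section Trees.
Variable Gamma : graph.
Local Notation V := (vertex Gamma).
Local Notation E := (edge Gamma).
Local Notation dart := (bool * E)%type.
Implicit Types (d : dart) (F : {set E}).

Definition dsrc d : V := endpt d.1 d.2.
Definition dtgt d : V := endpt (~~ d.1) d.2.
Definition drev d : dart := (~~ d.1, d.2).

Fixpoint walk (u : V) (q : seq dart) (v : V) : bool :=
  if q is d :: q' then (dsrc d == u) && walk (dtgt d) q' v else u == v.

Lemma walk_cat u q q' v :
  reflect (exists2 w, walk u q w & walk w q' v) (walk u (q ++ q') v).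
Proof.
elim: q u => [|d q IH] u /=.
  by apply: (iffP idP) => [uv|[w /eqP->//]]; exists u.
apply: (iffP andP) => [[-> /IH[w]]|[w /andP[-> qw] wv]]; first by exists w.
by split=> //; apply/IH; exists w.
Qed.

Lemma adjacentP F u v :
  reflect (exists d, [/\ d.2 \in F, dsrc d = u & dtgt d = v]) (adjacent F u v).
Proof.
apply: (iffP existsP) => [[e /andP[eF /existsP[s /andP[/eqP eu /eqP ev]]]]|].
  by exists (s, e).
case=> -[s e] [/= eF <- <-]; exists e; rewrite eF; apply/existsP.
by exists s; rewrite !eqxx.
Qed.

Lemma adjacent_sym F : symmetric (adjacent F).
Proof.
suff H u v : adjacent F u v -> adjacent F v u by move=> u v; apply/idP/idP; apply: H.
move=> /adjacentP[[s e] [/= eF <- <-]]; apply/adjacentP; exists (~~ s, e).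
by rewrite /dsrc /dtgt /= negbK.
Qed.

Lemma connect_adjacent_sym F : connect_sym (adjacent F).
Proof. exact/sym_connect_sym/adjacent_sym. Qed.

Lemma path_walk F u p : path (adjacent F) u p ->
  exists q, [/\ walk u q (last u p), map dsrc q = belast u p,
                map dtgt q = p & forall d, d \in q -> d.2 \in F].
Proof.
elim: p u => [|v p IH] u /=; first by exists [::]; rewrite /= eqxx.
move=> /andP[/adjacentP[d [dF <- <-]] /IH[q [qw qs qt qF]]].
exists (d :: q); split=> /=; rewrite ?eqxx ?qs ?qt //.
by move=> x; rewrite inE => /orP[/eqP->|/qF].
Qed.

Lemma connect_walk F u v : connect (adjacent F) u v ->
  exists2 q, walk u q v & forall d, d \in q -> d.2 \in F.
Proof. by move=> /connectP[p /path_walk[q [qw _ _ qF]] ->]; exists q. Qed.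

(** If the first edge recurred, its starting vertex [u] would occur again later on the path. *)
Lemma uniq_walk_edges u p q : map dsrc q = belast u p -> map dtgt q = p ->
  uniq (u :: p) -> uniq (map snd q).
Proof.
elim: q u p => [|d q IH] u [|v p] //= [du qs] [dv qt] /and3P[uvp vp up].
rewrite (IH v p) //= ?vp // andbT.
apply/mapP => -[d' d'q e_d]; case/negP: uvp.
have srcd' : dsrc d' \in v :: p by apply: mem_belast; rewrite -qs map_f.
have tgtd' : dtgt d' \in p by rewrite -qt map_f.
rewrite -du; case: d d' {du dv d'q} e_d srcd' tgtd' => s e [s' e'] /= <-.
by rewrite /dsrc /dtgt /= !inE; case: s s' => -[] //= h1 h2; rewrite ?h2 ?orbT.
Qed.

Lemma walk_cycle d q w d' : walk (dtgt d) q w -> w = dsrc d' ->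
  path [rel d d' : dart | dtgt d == dsrc d'] d (rcons q d').
Proof.
elim: q d => [|d1 q IH] d /=; first by move=> /eqP-> ->; rewrite eqxx.
by move=> /andP[/eqP e1 qw] ew; rewrite e1 eqxx IH.
Qed.

Lemma connected_circuit F d : connect (adjacent F) (dtgt d) (dsrc d) ->
  d.2 \notin F -> exists2 c, circuit c & forall d', d' \in c -> d'.2 \in d.2 |: F.
Proof.
move=> /connectP[p0 pF0 lp0] dF; case/shortenP: pF0 lp0 => p pF up _ lp.
have [q [qw qs qt qF]] := path_walk pF.
exists (d :: q); last first.
  by move=> d'; rewrite !inE => /orP[/eqP->|/qF->]; rewrite ?eqxx ?orbT.
apply/and4P; split=> //.
- by apply: (walk_cycle qw).
- rewrite /= (uniq_walk_edges qs qt up) andbT.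
  by apply/mapP => -[d' /qF] d'F dd'; rewrite dd' d'F in dF.
- change (uniq (dsrc d :: map dsrc q)); rewrite qs lp cons_uniq -rcons_uniq -lastI.
  exact: up.
Qed.

Definition acyclic F := forall c, circuit c -> exists2 d, d \in c & d.2 \notin F.

Lemma acyclic_potential (K : groupType) (f : E -> K) F : acyclic F ->
  exists tau : V -> K, forall e, e \in F ->
    tau (endpt false e) = tau (endpt true e) * f e.
Proof.
have [n] := ubnP #|F|; elim: n F => // n IH F Fn acF.
have [->|[e eF]] := set_0Vmem F; first by exists (fun=> 1) => e; rewrite inE.
have [|c cc|tau tauP] := IH (F :\ e).
- by rewrite (cardsD1 e F) eF in Fn.
- have [d dc dF] := acF c cc; exists d => //.
  by rewrite !inE (negPf dF) andbF.
pose C := connect (adjacent (F :\ e)) (endpt false e).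
have nC : ~~ C (endpt true e).
  apply/negP => /(@connected_circuit _ (true, e)) [|c cc cF].
    by rewrite !inE eqxx.
  have [d dc /negP[]] := acF c cc; have := cF d dc.
  by rewrite !inE /= => /orP[/eqP->|/andP[]].
(* Without [e] its ends lie in different components. Left multiplication by [k] on the component of
   e(-1) keeps the other relations and enforces that of [e]. *)
pose k := tau (endpt true e) * f e * (tau (endpt false e))^-1.
exists (fun x => if C x then k * tau x else tau x) => e' e'F.
have [->|e'e] := eqVneq e' e.
  by rewrite (negPf nC) /C connect0 /k mulgVK.
have e'Fe : e' \in F :\ e by rewrite !inE e'e.
have -> : C (endpt false e') = C (endpt true e').
  apply: (same_connect_r (connect_adjacent_sym _)); apply: connect1.
  by apply/adjacentP; exists (false, e').
by rewrite (tauP _ e'Fe); case: ifP => // _; rewrite mulgA.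
Qed.

Lemma crossing_dart (W : {set V}) u v : connected_graph Gamma ->
  u \in W -> v \notin W -> exists2 d, dsrc d \in W & dtgt d \notin W.
Proof.
move=> conG uW vW; apply: contrapT => noX.
suff [q qw _] : exists2 q, walk u q v & forall d, d \in q -> d.2 \in [set: E].
  elim: q u qw uW => [|d q IH] u /=; first by move=> /eqP-> vW'; rewrite vW' in vW.
  move=> /andP[/eqP <-] /IH W' dW; case: (boolP (dtgt d \in W)) => // dW'.
  by case: noX; exists d.
exact/connect_walk/conG.
Qed.

(** A circuit not avoiding the new edge is, after rotation, that edge followed by edges with both
    ends in [W], so it cannot close up at the end outside [W]. *)
Lemma acyclicU1 (W : {set V}) F d : acyclic F ->
  (forall e, e \in F -> forall s, endpt s e \in W) ->
  dsrc d \in W -> dtgt d \notin W -> acyclic (d.2 |: F).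
Proof.
move=> acF FW dW dW' c0 cc0; apply: contrapT => allF.
have {}allF d' : d' \in c0 -> d'.2 \in d.2 |: F.
  by move=> d'c; apply: contrapT => /negP d'F; apply: allF; exists d'.
have [d1 d1c d1F] := acF _ cc0.
have d1d : d1.2 = d.2 by have := allF _ d1c; rewrite !inE (negPf d1F) orbF => /eqP.
have [i c ec] := rot_to d1c.
have cF d' : d' \in c -> d'.2 \in F.
  move=> d'c; have : d'.2 \in d.2 |: F.
    by apply: allF; rewrite -(mem_rot i) ec inE d'c orbT.
  rewrite !inE => /orP[/eqP d'd|//].
  case/and4P: cc0 => _ _ uc _; move: uc; rewrite -(rot_uniq i) -map_rot ec /=.
  by rewrite d1d -d'd map_f.
have cW d' : d' \in c -> dsrc d' \in W /\ dtgt d' \in W.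
  by move=> /cF d'F; split; apply: FW.
case/and4P: cc0 => _ + _ _; rewrite -(rot_cycle i) ec.
rewrite /= rcons_path /= -/(dsrc _) -/(dtgt _).
have ends : dsrc d1 != dtgt d1.
  have : dsrc d != dtgt d by apply: contraNneq dW' => <-.
  rewrite /dsrc /dtgt d1d; case: (d) (d1) => [s e] [s' e'] /=.
  by case: s s' => -[] //=; rewrite eq_sym.
have [dW1|dW1] : dsrc d1 \notin W \/ dtgt d1 \notin W.
  move: dW'; rewrite /dsrc /dtgt d1d; case: (d) (d1) => [s e] [s' e'] /=.
  by case: s s' => -[] /=; auto.
- case/lastP: c {ec} cF cW => [|c d'] cF cW.
    by move=> /= /eqP e1; rewrite e1 eqxx in ends.
  rewrite last_rcons => /andP[_ /eqP e1]; case/negP: dW1.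
  by rewrite -[dsrc d1]e1; case: (cW d'); rewrite ?mem_rcons ?mem_head.
- case: c {ec} cF cW => [|d' c] cF cW.
    by move=> /= /eqP e1; rewrite e1 eqxx in ends.
  move=> /= /andP[/andP[/eqP e1 _] _]; case/negP: dW1.
  by rewrite [dtgt d1]e1; case: (cW d'); rewrite ?mem_head.
Qed.

(** If a vertex were missing, an edge leaving [VT] could be added together with its far end. *)
Lemma maximal_subtreeT VT ET : connected_graph Gamma -> maximal_subtree VT ET ->
  VT = [set: V].
Proof.
move=> conG [[[v0 v0V] eV cV acE] maxT].
apply/setP => w; rewrite inE; apply: contrapT => /negP wV.
have [d dV dV'] := crossing_dart conG v0V wV.
suff tW : subtree (dtgt d |: VT) (d.2 |: ET).
  have [/setP/(_ (dtgt d))] := maxT _ _ tW (finset.subsetUr _ _) (finset.subsetUr _ _).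
  by rewrite !inE eqxx (negPf dV').
have sub : subrel (connect (adjacent ET)) (connect (adjacent (d.2 |: ET))).
  apply: connect_sub => x y /adjacentP[d' [d'E <- <-]]; apply: connect1.
  by apply/adjacentP; exists d'; rewrite inE d'E orbT.
have cd : connect (adjacent (d.2 |: ET)) (dsrc d) (dtgt d).
  by apply: connect1; apply/adjacentP; exists d; rewrite setU11.
have cd' x : x \in dtgt d |: VT -> connect (adjacent (d.2 |: ET)) (dsrc d) x.
  by rewrite !inE => /orP[/eqP->//|xV]; apply/sub/cV.
split.
- by exists v0; rewrite inE v0V orbT.
- move=> e; rewrite !inE => /orP[/eqP->|eE] s; rewrite !inE; last by rewrite eV ?orbT.
  move: dV dV'; rewrite /dsrc /dtgt; case: (d) => [s' e'] /= dV _.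
  by case: s s' dV => -[] /= h; rewrite ?h ?eqxx ?orbT.
- move=> x y /cd' xc /cd' yc; apply: connect_trans yc.
  by rewrite connect_adjacent_sym.
- exact: acyclicU1 dV dV'.
Qed.

Lemma maximal_subtree_walk VT ET u v : connected_graph Gamma ->
  maximal_subtree VT ET ->
  exists2 q, walk u q v & forall d, d \in q -> d.2 \in ET.
Proof.
move=> conG maxT; have VTT := maximal_subtreeT conG maxT.
by case: maxT => -[_ _ cV _] _; apply/connect_walk/cV; rewrite VTT inE.
Qed.

Lemma maximal_subtree_acyclic VT ET : maximal_subtree VT ET -> acyclic ET.
Proof. by case=> -[]. Qed.

End Trees.

(** * Representations of a labeled graph and detection of reduced paths *)

Section Representations.
Variables (Gamma : graph) (lam : bool -> edge Gamma -> int).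
Local Notation V := (vertex Gamma).
Local Notation E := (edge Gamma).
Local Notation dart := (bool * E)%type.
Implicit Types (d : dart) (l : seq (dart * int)).

Definition dlam d : int := lam d.1 d.2.

(** An entry [(d, k)] is the dart [d] followed by the [k]-th power of the generator at its target.
    The excluded steps are the backtrackings that the edge relation cancels. *)
Definition reduced_step (x y : dart * int) : bool :=
  ~~ ((y.1 == drev x.1) && (dlam (drev x.1) %| x.2)%Z).

Definition reduced l := sorted reduced_step l.

Definition is_rep (K : groupType) (a : V -> K) (b : E -> K) : Prop :=
  forall e, gexpz (a (endpt true e)) (lam true e) * b e =
            b e * gexpz (a (endpt false e)) (lam false e).

(** Weaker than infinite order, so that finite groups qualify, yet enough to deduce from a vanishing
    power that a backtracking could be cancelled. *)
Definition faithful_labels (K : groupType) (a : V -> K) : Prop :=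
  forall s e m, gexpz (a (endpt s e)) m = 1 -> (lam s e %| m)%Z.

Section Evaluation.
Variables (K : groupType) (a : V -> K) (b : E -> K).

Definition dart_eval d : K := if d.1 then b d.2 else (b d.2)^-1.

Definition path_eval l : K :=
  foldr (fun x y => dart_eval x.1 * gexpz (a (dtgt x.1)) x.2 * y) 1 l.

Lemma path_eval_cat l l' : path_eval (l ++ l') = path_eval l * path_eval l'.
Proof. by elim: l => [|x l IH]; rewrite ?mul1g //= IH !mulgA. Qed.

Lemma dart_eval_rev d : dart_eval (drev d) = (dart_eval d)^-1.
Proof. by rewrite /dart_eval /=; case: d.1; rewrite ?invgK. Qed.

Hypothesis ab : is_rep a b.

Lemma rep_edge e j :
  gexpz (a (endpt true e)) (lam true e * j) * b e =
  b e * gexpz (a (endpt false e)) (lam false e * j).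
Proof.
rewrite !gexpzM; set x := gexpz _ (lam true e); set y := gexpz _ (lam false e).
have <- : x ^ b e = y by rewrite conjgE ab mulKg.
by rewrite gexpzJ conjgE !mulgA mulgV mul1g.
Qed.

Lemma rep_dart d j :
  gexpz (a (dsrc d)) (dlam d * j) * dart_eval d =
  dart_eval d * gexpz (a (dtgt d)) (dlam (drev d) * j).
Proof.
case: d => -[] e; rewrite /dart_eval /dsrc /dtgt /dlam /=; first exact: rep_edge.
by apply: (mulgI (b e)); rewrite !mulgA -rep_edge mulgK mulgV mul1g.
Qed.

End Evaluation.

Lemma morph_dart_eval (K K' : groupType) (b : E -> K) (b' : E -> K') (f : K -> K') d :
  {morph f : x y / x * y} -> (forall e, f (b e) = b' e) ->
  f (dart_eval b d) = dart_eval b' d.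
Proof.
move=> fM fb; rewrite /dart_eval.
by case: d.1; rewrite ?(morph_gV fM) fb.
Qed.

Lemma morph_path_eval (K K' : groupType) (a : V -> K) (b : E -> K)
    (a' : V -> K') (b' : E -> K') (f : K -> K') l :
  {morph f : x y / x * y} -> (forall v, f (a v) = a' v) ->
  (forall e, f (b e) = b' e) ->
  f (path_eval a b l) = path_eval a' b' l.
Proof.
move=> fM fa fb; elim: l => [|[d k] l IH] /=; first exact: morph_g1.
by rewrite !fM (morph_gexpz fM) fa IH (morph_dart_eval _ fM fb).
Qed.

(** * Wreath representations counting edge crossings *)

Section WreathRepresentation.
Variables (K : groupType) (C : zmodType) (a : V -> K) (b : E -> K).
Variable F : E -> K -> C.

Definition wreath_vertex v : wreath K C := (0%R, a v).
Definition wreath_edge e : wreath K C := (F e, b e).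

(** Right invariance under the edge group makes [F e] a function on the edges over [e] in the
    [K]-cover; it is the base part of the edge relation in the wreath product. *)
Definition edge_function := forall e z,
  F e (z * gexpz (a (endpt true e)) (lam true e)) = F e z.

Lemma wreath_rep : is_rep a b -> edge_function ->
  is_rep wreath_vertex wreath_edge.
Proof.
move=> ab inv e; rewrite !sd_gexpz0 !sd_mulE.
apply: (congr2 pair); last exact: ab.
rewrite add0r act0 addr0; apply/funext => z; exact: inv.
Qed.

(** A reversed dart starting at [z] is the inverse of the lift indexed by [z * (b d.2)^-1], hence
    the sign and the shift. *)
Definition crossing d z : C :=
  if d.1 then F d.2 z else (- F d.2 (z * (b d.2)^-1))%R.

Lemma wreath_dart_eval d :
  dart_eval wreath_edge d = (crossing d, dart_eval b d).
Proof.
rewrite /dart_eval /crossing; case: d.1 => //.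
Qed.

Lemma wreath_eval_cons d k l z :
  ((path_eval wreath_vertex wreath_edge ((d, k) :: l)).1 z =
   crossing d z + (path_eval wreath_vertex wreath_edge l).1
                     (z * (dart_eval b d * gexpz (a (dtgt d)) k))%g)%R.
Proof.
rewrite [path_eval _ _ _]/= sd_gexpz0 wreath_fstM; congr (_ + _)%R.
  by rewrite wreath_fstM wreath_dart_eval /= addr0.
by rewrite wreath_dart_eval.
Qed.

Lemma wreath_eval_snd l :
  (path_eval wreath_vertex wreath_edge l).2 = path_eval a b l.
Proof. exact: (morph_path_eval (f := fun x : wreath K C => x.2 : K)). Qed.

Lemma wreath_eval_eq0 l z :
  (forall p x s, l = p ++ x :: s -> crossing x.1 (z * path_eval a b p) = 0%R) ->
  (path_eval wreath_vertex wreath_edge l).1 z = 0%R.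
Proof.
elim: l z => [//|[d k] l IH] z H.
rewrite wreath_eval_cons -[z in crossing _ z]mulg1.
rewrite (H [::] (d, k) l) // add0r; apply: IH => p x s e.
by rewrite -mulgA; apply: (H ((d, k) :: p) x s); rewrite e.
Qed.

End WreathRepresentation.

Section EdgeIndicator.
Variables (K : groupType) (C : nzRingType) (a : V -> K) (b : E -> K).

(* The characteristic function of one edge of the [K]-cover of the graph: the
   edges over [e0] correspond to the cosets of the edge group of [e0]. *)
Definition edge_indicator (e0 : E) (q : K) (e : E) (z : K) : C :=
  if (e == e0) && `[< exists j : int,
       z = q * gexpz (a (endpt true e0)) (lam true e0 * j) >]
  then 1%R else 0%R.

Lemma edge_indicatorP e0 q e z : edge_indicator e0 q e z <> 0%R ->
  e = e0 /\ exists j, z = q * gexpz (a (endpt true e0)) (lam true e0 * j).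
Proof.
rewrite /edge_indicator; case: eqP => [->|//] /=.
by case: asboolP => // -[j ->] _; split=> //; exists j.
Qed.

Lemma edge_indicator1 e0 q : edge_indicator e0 q e0 q = 1%R.
Proof.
rewrite /edge_indicator eqxx asboolT //; exists 0%R.
by rewrite mulr0 gexpz0 mulg1.
Qed.

Lemma edge_indicator_function e0 q : edge_function a (edge_indicator e0 q).
Proof.
move=> e z; rewrite /edge_indicator; case: eqP => [->|//] /=.
congr (if _ then _ else _); apply: asbool_equiv_eq; split=> -[j ez].
  exists (j - 1)%R; rewrite mulrBr mulr1 gexpzB mulgA -ez.
  by rewrite mulgK.
by exists (j + 1)%R; rewrite mulrDr mulr1 gexpzD mulgA ez.
Qed.

End EdgeIndicator.

(** The vertices of the cover over [u] are the cosets of the subgroup generated by [a u], so the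
    lift of a path [l] visits no vertex twice. Including all subpaths allows an induction on the
    length. *)
Definition detects (K : groupType) (a : V -> K) (b : E -> K) l : Prop :=
  forall p m s u, l = p ++ m ++ s -> m != [::] -> walk u (map fst m) u ->
    forall j, path_eval a b m <> gexpz (a u) j.

Lemma detects_morph (K K' : groupType) (a : V -> K) (b : E -> K)
    (a' : V -> K') (b' : E -> K') (f : K -> K') l :
  {morph f : x y / x * y} -> (forall v, f (a v) = a' v) ->
  (forall e, f (b e) = b' e) ->
  detects a' b' l -> detects a b l.
Proof.
move=> fM fa fb dl p m s u el m0 wm j /(congr1 f).
rewrite (morph_path_eval _ fM fa fb) (morph_gexpz fM) fa.
exact: (dl p m s u el m0 wm j).
Qed.

Section FirstEdge.
Variables (K : groupType) (C : nzRingType) (a : V -> K) (b : E -> K).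
Hypotheses (ab : is_rep a b) (fab : faithful_labels a).

(** The index of the lifted edge that [d] crosses when it starts at 1. *)
Let origin d : K := if d.1 then 1 else (b d.2)^-1.

Lemma crossing_origin d d' z :
  crossing b (edge_indicator C a d.2 (origin d)) d' z <> 0%R ->
  (d' = d /\ exists j, z = gexpz (a (dsrc d)) j) \/
  (d' = drev d /\
     exists j, z = dart_eval b d * gexpz (a (dtgt d)) (dlam (drev d) * j)).
Proof.
case: d d' => [s e] [s' e'].
have nz : crossing b (edge_indicator C a e (origin (s, e))) (s', e') z <> 0%R ->
  edge_indicator C a e (origin (s, e)) e' (if s' then z else z * (b e')^-1) <> 0%R.
  by rewrite /crossing; case: s' => //= H H'; apply: H; rewrite H' oppr0.
move=> /nz /edge_indicatorP[-> [j]].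
have rd := rep_dart ab (s, e) j.
case: s s' rd {nz} => -[];
  rewrite /dsrc /dtgt /dlam /dart_eval /drev /origin /= => rd ez.
- by left; split=> //; exists (lam true e * j)%R; rewrite ez mul1g.
- right; split=> //; exists j; rewrite -rd -(mulgVK (b e) z) ez mul1g //.
- by right; split=> //; exists j; rewrite ez.
- left; split=> //; exists (lam false e * j)%R.
  by rewrite -(mulgVK (b e) z) ez -rd mulgVK.
Qed.

(** The lift from 1 crosses its first edge only once. A second forward crossing would return to the
    first vertex, against detection of [belast (d, k) l]; a backward one would return to the second
    vertex, against detection of [l] or, if immediate, reducedness. *)
Lemma wreath_first_edge d k l :
  reduced ((d, k) :: l) -> walk (dsrc d) (d :: map fst l) (dsrc d) ->
  detects a b l -> detects a b (belast (d, k) l) ->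
  let F := edge_indicator C a d.2 (origin d) in
  (path_eval (wreath_vertex C a) (wreath_edge b F) ((d, k) :: l)).1 1 <> 0%R.
Proof.
move=> red wl dl1 dl2 F; rewrite wreath_eval_cons.
rewrite [X in (_ + X)%R]wreath_eval_eq0; last first.
  move=> p x s el; rewrite mul1g; apply: contrapT => /crossing_origin.
  have [w wp wx] : exists2 w, walk (dtgt d) (map fst p) w
                            & walk w (x.1 :: map fst s) (dsrc d).
    by apply/walk_cat; case/andP: wl => _; rewrite el map_cat.
  have wE : w = dsrc x.1 by case/andP: wx => /eqP.
  case=> [[xd [j ej]]|[xd [j ej]]].
  - have eb : belast (d, k) l = [::] ++ ((d, k) :: p) ++ belast x s.
      by rewrite el belast_cat /= -cat_rcons -lastI.
    apply: (dl2 _ _ _ (dsrc d) eb _ _ j) => //=.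
    by rewrite eqxx (_ : dsrc d = w) // wE xd.
  - have ep : path_eval a b p = gexpz (a (dtgt d)) (dlam (drev d) * j - k).
      apply: (mulgI (dart_eval b d * gexpz (a (dtgt d)) k)).
      by rewrite ej -mulgA -gexpzD addrC addrNK.
    rewrite wE xd (_ : dsrc (drev d) = dtgt d) // in wp.
    (* For empty [p] the two darts are consecutive, and [faithful_labels] gives the divisibility
       that [reduced] excludes. *)
    case: p el ep wp {ej} => [|y p] el ep wp.
      have [_ /=] : True /\ path reduced_step (d, k) l by [].
      rewrite el /= /reduced_step xd eqxx /= => /andP[/negP[]].
      have := fab (esym ep : gexpz (a (endpt (~~ d.1) d.2)) _ = 1).
      rewrite -/(dlam (drev d)) => dvd; rewrite -(subKr (dlam (drev d) * j)%R k).
      by apply: rpredB => //; apply: dvdz_mulr.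
    exact: (dl1 [::] (y :: p) (x :: s) _ el _ wp _ ep).
rewrite addr0 /crossing /F /origin.
by case: d.1; rewrite ?mul1g edge_indicator1 => /eqP;
   rewrite ?oppr_eq0 ?oner_eq0.
Qed.

End FirstEdge.

(* Among the representations obtained from a given one by wreath products,
   some detect [l]: after treating the two maximal proper subpaths, [l] can only
   fail to be detected if it closes up in the cover, and there it crosses its
   first edge exactly once. *)
Lemma exists_detecting (C : nzRingType)
    (P : forall K : groupType, (V -> K) -> (E -> K) -> Prop) l :
  (forall K a b, P K a b -> is_rep a b /\ faithful_labels a) ->
  (forall K a b e q, P K a b ->
     P (wreath K C) (wreath_vertex C a)
       (wreath_edge b (edge_indicator C a e q))) ->
  reduced l ->
  forall K a b, P K a b -> exists K' a' b', [/\ P K' a' b', detects a' b' l &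
    exists f : K' -> K, [/\ {morph f : x y / x * y},
       forall v, f (a' v) = a v & forall e, f (b' e) = b e]].
Proof.
move=> PR PW; have [n] := ubnP (size l); elim: n l => // n IH l ln red K a b Pab.
case: l ln red => [|[d k] l] ln red.
  exists K, a, b; split=> //; last by exists id.
  by move=> p m s u; case: p => //; case: m.
have [|K1 [a1 [b1 [P1 D1 [f1 [f1M f1a f1b]]]]]] := IH l ln _ K a b Pab.
  by case: l red {ln} => //= x l /andP[].
have [||K2 [a2 [b2 [P2 D2 [f2 [f2M f2a f2b]]]]]] :=
  IH (belast (d, k) l) _ _ K1 a1 b1 P1.
- by rewrite size_belast.
- by move: red; rewrite /reduced lastI -cats1 => /cat_sorted2[].
have D12 : detects a2 b2 l by apply: detects_morph D1; eauto.
pose F := edge_indicator C a2 d.2 (if d.1 then 1 else (b2 d.2)^-1).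
(* A subpath missing the first or the last entry is already detected; only the whole path
   remains. *)
have D0 : (forall u j, walk u (d :: map fst l) u ->
           path_eval a2 b2 ((d, k) :: l) <> gexpz (a2 u) j) ->
          detects a2 b2 ((d, k) :: l).
  move=> H [|x p] m s u; last by case=> _ el; apply: (D12 p m s u).
  case/lastP: s => [|s y]; first by rewrite /= cats0 => <- _ wl j; apply: H.
  rewrite /= lastI -rcons_cat => /rcons_inj[el _].
  exact: (D2 [::] m s u el).
have F2 : [/\ {morph f1 \o f2 : x y / x * y}, forall v, (f1 \o f2) (a2 v) = a v
            & forall e, (f1 \o f2) (b2 e) = b e].
  split=> [x y|v|e] /=; first by rewrite f2M f1M.
    by rewrite f2a f1a.
  by rewrite f2b f1b.
have [H|] := pselect (forall u j, walk u (d :: map fst l) u ->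
           path_eval a2 b2 ((d, k) :: l) <> gexpz (a2 u) j).
  by exists K2, a2, b2; split=> //; [apply: D0|exists (f1 \o f2)].
move=> noH; have [R2 FL2] := PR _ _ _ P2.
have wl : walk (dsrc d) (d :: map fst l) (dsrc d).
  apply: contrapT => nwl; apply: noH => u j wl.
  by case: nwl; case/andP: (wl) => /eqP du _; rewrite du.
exists (wreath K2 C), (wreath_vertex C a2), (wreath_edge b2 F).
split; first exact: PW; last first.
  exists (f1 \o f2 \o snd); case: F2 => FM Fa Fb; split.
  - by move=> x y /=; rewrite f2M f1M.
  - exact: Fa.
  - exact: Fb.
have W12 : detects (wreath_vertex C a2) (wreath_edge b2 F) l.
  by apply: (detects_morph (f := fun x : wreath K2 C => x.2 : K2)) D12.
have W2 : detects (wreath_vertex C a2) (wreath_edge b2 F) (belast (d, k) l).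
  by apply: (detects_morph (f := fun x : wreath K2 C => x.2 : K2)) D2.
move=> [|x p] m s u; last by case=> _ el; apply: (W12 p m s u).
case/lastP: s => [|s y]; last first.
  rewrite /= lastI -rcons_cat => /rcons_inj[el _].
  exact: (W2 [::] m s u el).
rewrite /= cats0 => <- _ _ j ev.
(* Powers of vertex elements have base component 0, unlike the whole path. *)
have nz : (path_eval (wreath_vertex C a2) (wreath_edge b2 F) ((d, k) :: l)).1 1 <> 0%R.
  exact: (wreath_first_edge R2 FL2 red wl D12 D2).
by apply: nz; rewrite ev sd_gexpz0.
Qed.

End Representations.

(** * The tautological representation in the GBS-group *)

Lemma word_class_eval (X : choiceType) R (w : seq (X * bool)) :
  word_class R w = word_eval (pres_gen R) w.
Proof.
elim: w => [//|[x b] w IH]; rewrite -cat1s -pres_mulE IH.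
case: b => //.
rewrite (_ : word_class R _ = (pres_gen R x)^-1) //.
exact: (esym (pres_invE R [:: (x, true)])).
Qed.

Lemma vertex_word_eval Gamma (ET : {set edge Gamma}) (K : groupType)
    (h : gbs_gen ET -> K) v k :
  word_eval h (vertex_word ET v k) = gexpz (h (inl v)) k.
Proof.
have E b n : word_eval h (nseq n (inl v, b)) =
    (if b then h (inl v) else (h (inl v))^-1) ^+ n.
  by elim: n => [//|n IH]; rewrite expgS -IH.
by case: k => n; rewrite /vertex_word E // expVgn.
Qed.

Section GBSGroup.
Variables (Gamma : graph) (lam : bool -> edge Gamma -> int).
Variables (VT : {set vertex Gamma}) (ET : {set edge Gamma}).
Hypotheses (conG : connected_graph Gamma) (maxT : maximal_subtree VT ET).
Local Notation V := (vertex Gamma).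
Local Notation E := (edge Gamma).
Local Notation G := (gbs_group lam ET).
Local Notation grel := (@gbs_rel Gamma lam ET).
Local Notation gvertex := (gbs_vertex lam ET).

Definition gbs_edge (e : E) : G :=
  if insub e is Some t then pres_gen grel (inr t) else 1.

Lemma gbs_edge_tree e : e \in ET -> gbs_edge e = 1.
Proof. by move=> eT; rewrite /gbs_edge insubN // negbK. Qed.

Lemma gbs_edge_stable (t : {e | e \notin ET}) :
  gbs_edge (val t) = pres_gen grel (inr t).
Proof. by rewrite /gbs_edge valK. Qed.

Lemma gbs_is_rep : is_rep lam gvertex gbs_edge.
Proof.
have rel u v : grel u v ->
    word_eval (pres_gen grel) u = word_eval (pres_gen grel) v.
  by rewrite -!word_class_eval => uv; apply/word_class_eqP/PresRel.
move=> e; case: (boolP (e \in ET)) => eT.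
  rewrite gbs_edge_tree // mulg1 mul1g.
  by have := rel _ _ (GBSTree lam eT); rewrite !vertex_word_eval.
have := rel _ _ (GBSStable lam (exist (fun e => e \notin ET) e eT)).
rewrite /= word_eval_cat !vertex_word_eval /= mulg1.
rewrite -(gbs_edge_stable (exist (fun e => e \notin ET) e eT)) /= => <-.
by rewrite mulVKg.
Qed.

(** Conjugating by the potential [tau] sends the tree edges to 1, so the defining relations hold;
    with [tau v0 = 1] loops at [v0] keep their value. *)
Lemma rep_hom (v0 : V) (K : groupType) (a : V -> K) (b : E -> K) :
  is_rep lam a b -> exists (f : G -> K) (tau : V -> K),
  [/\ {morph f : x y / x * y}, tau v0 = 1,
      forall v, f (gvertex v) = tau v * a v * (tau v)^-1
    & forall e, f (gbs_edge e) =
                tau (endpt true e) * b e * (tau (endpt false e))^-1].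
Proof.
move=> ab.
have [tau0 tau0P] := acyclic_potential b (maximal_subtree_acyclic maxT).
have [tau [tau1 tauP]] : exists tau : V -> K, tau v0 = 1 /\ forall e, e \in ET ->
    tau (endpt false e) = tau (endpt true e) * b e.
  exists (fun v => (tau0 v0)^-1 * tau0 v); split=> [|e eT]; first exact: mulVg.
  by rewrite tau0P // mulgA.
pose h (x : gbs_gen ET) := match x with
  | inl v => tau v * a v * (tau v)^-1
  | inr t => tau (endpt true (val t)) * b (val t) * (tau (endpt false (val t)))^-1
  end.
have [|f [fM fE]] := @presented_lift _ grel K h.
  move=> u v [e eT|t].
    rewrite !vertex_word_eval /= !gexpz_conj tauP // invgM !mulgA; congr (_ * _).
    by apply: (mulIg (b e)); rewrite mulgVK -!mulgA; congr (_ * _); apply: ab.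
  rewrite /= word_eval_cat !vertex_word_eval /= !gexpz_conj !invgM invgK mulg1.
  by rewrite !mulgA !mulgVK; congr (_ * _); rewrite -!mulgA ab mulKg.
exists f, tau; split=> //.
  by move=> v; rewrite fE.
move=> e; case: (boolP (e \in ET)) => eT.
  by rewrite gbs_edge_tree // (morph_g1 fM) -tauP // mulgV.
by rewrite (gbs_edge_stable (exist (fun e => e \notin ET) e eT)) fE.
Qed.

Lemma rep_hom_path (K : groupType) (a : V -> K) (b : E -> K) (f : G -> K) tau u l v :
  {morph f : x y / x * y} ->
  (forall v, f (gvertex v) = tau v * a v * (tau v)^-1) ->
  (forall e, f (gbs_edge e) = tau (endpt true e) * b e * (tau (endpt false e))^-1) ->
  walk u (map fst l) v ->
  f (path_eval gvertex gbs_edge l) = tau u * path_eval a b l * (tau v)^-1.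
Proof.
move=> fM fa fb; elim: l u => [|[d k] l IH] u /=.
  by move=> /eqP->; rewrite (morph_g1 fM) mulg1 mulgV.
move=> /andP[/eqP <-] /IH fl; rewrite !fM fl (morph_gexpz fM) fa gexpz_conj.
have -> : f (dart_eval gbs_edge d) = tau (dsrc d) * dart_eval b d * (tau (dtgt d))^-1.
  rewrite /dart_eval /dsrc /dtgt; case: d.1; rewrite ?(morph_gV fM) fb //.
  by rewrite !invgM invgK mulgA.
by rewrite !mulgA !mulgVK.
Qed.

Definition path_elt u v n (x : G) : Prop := exists k0 l,
  [/\ walk u (map fst l) v, size l = n
    & x = gexpz (gvertex u) k0 * path_eval gvertex gbs_edge l].

Lemma path_elt_vertex u k : path_elt u u 0 (gexpz (gvertex u) k).
Proof. by exists k, [::]; rewrite /= eqxx mulg1. Qed.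

Lemma path_elt_dart d : path_elt (dsrc d) (dtgt d) 1 (dart_eval gbs_edge d).
Proof. by exists 0%R, [:: (d, 0%R)]; rewrite /= !eqxx !mulg1 mul1g. Qed.

Lemma path_eltM u v w m n x y :
  path_elt u v m x -> path_elt v w n y -> path_elt u w (m + n) (x * y).
Proof.
move=> [k0 [l [ul lm ->]]] [k1 [l' [vl' l'n ->]]].
elim: l u k0 m ul lm => [|[d k] l IH] u k0 m /=.
  move=> /eqP-> <-; exists (k0 + k1)%R, l'; split=> //.
  by rewrite mulg1 gexpzD mulgA.
move=> /andP[du ul] <-; have [k2 [l2 [ul2 l2n e]]] := IH _ k _ ul erefl.
exists k0, ((d, k2) :: l2); split=> /=; first by rewrite du.
  by rewrite l2n.
by rewrite -!mulgA; do 2 congr (_ * _); rewrite -e !mulgA.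
Qed.

Lemma path_eltV u v n x : path_elt u v n x -> path_elt v u n x^-1.
Proof.
move=> [k0 [l [ul <- ->]]]; elim: l u k0 ul => [|[d k] l IH] u k0 /=.
  by move=> /eqP->; rewrite mulg1 -gexpzN; apply: path_elt_vertex.
move=> /andP[/eqP <-] /IH-/(_ k) H.
pose y := gexpz (gvertex (dtgt d)) k * path_eval gvertex gbs_edge l.
rewrite (_ : _ * _ = gexpz (gvertex (dsrc d)) k0 * dart_eval gbs_edge d * y);
  last by rewrite /y !mulgA.
rewrite invgM [(_ * dart_eval _ _)^-1]invgM -addn1; apply: path_eltM H _.
rewrite -dart_eval_rev -gexpzN -[1%N]addn0.
apply: path_eltM; last exact: path_elt_vertex.
have := path_elt_dart (drev d); congr (path_elt _ _ _ _).
by rewrite /dtgt /dsrc /= negbK.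
Qed.

Lemma path_elt_tree u v : exists n, path_elt u v n 1.
Proof.
have [q] := maximal_subtree_walk u v conG maxT.
elim: q u => [|d q IH] u /=.
  by move=> /eqP-> _; exists 0%N; apply: (path_elt_vertex _ 0).
move=> /andP[/eqP <- /IH qv] qT.
have [|n H] := qv; first by move=> d' d'q; apply: qT; rewrite inE d'q orbT.
exists (1 + n)%N; rewrite -(mulg1 1); apply: path_eltM H.
have <- : dart_eval gbs_edge d = 1; last exact: path_elt_dart.
have dT : d.2 \in ET by apply: qT; rewrite mem_head.
by rewrite /dart_eval gbs_edge_tree // invg1; case: d.1.
Qed.

Lemma path_eltP v0 (x : G) : exists n, path_elt v0 v0 n x.
Proof.
apply: (@presented_ind _ grel (fun x => exists n, path_elt v0 v0 n x)).
  split=> [|{}x y [m xm] [n yn]]; first exact: path_elt_tree.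
  by exists (m + n)%N; apply: path_eltM xm (path_eltV yn).
have conj u v (y : G) n : path_elt u v n y -> exists n, path_elt v0 v0 n y.
  move=> yn; have [n1 H1] := path_elt_tree v0 u; have [n2 H2] := path_elt_tree v v0.
  exists (n1 + n + n2)%N; rewrite -[y]mul1g -[_ * y]mulg1.
  exact: path_eltM (path_eltM H1 yn) H2.
case=> [v|t].
  by apply: (conj v v _ 0%N); have := path_elt_vertex v 1; rewrite gexpz1.
by rewrite -gbs_edge_stable; apply: (conj _ _ _ 1%N (path_elt_dart (true, val t))).
Qed.

Lemma reduced_splitN l : ~~ reduced lam l ->
  exists p x y s, l = p ++ x :: y :: s /\ ~~ reduced_step lam x y.
Proof.
case: l => [//|x l]; elim: l x => [//|y l IH] x.
rewrite /reduced /= negb_and => /orP[xy|/IH[p [x' [y' [s [e H]]]]]].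
  by exists [::], x, y, l.
by exists (x :: p), x', y', s; rewrite e.
Qed.

(** A shortest loop representing [x] is reduced, since an excluded step would let two darts
    cancel. *)
Lemma reduced_path v0 (x : G) : exists k0 l,
  [/\ walk v0 (map fst l) v0, reduced lam l
    & x = gexpz (gvertex v0) k0 * path_eval gvertex gbs_edge l].
Proof.
have exn : exists n, `[< path_elt v0 v0 n x >].
  by have [n xn] := path_eltP v0 x; exists n; apply/asboolP.
have [n /asboolP[k0 [l [wl ln xE]]] minn] := ex_minnP exn.
exists k0, l; split=> //; apply: contrapT => /negP.
move=> /reduced_splitN[p [[d k] [[d' k'] [s [lE]]]]].
rewrite negbK /= => /andP[/eqP d'E /dvdzP[j kE]].
rewrite lE map_cat /= in wl.
have /walk_cat[w wp /= /and3P[/eqP dw d'd ws]] := wl.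
suff /asboolP/minn : path_elt v0 v0 (size p + size s) x.
  by rewrite -ln lE size_cat /= !addnS leqNgt ltnS leqnSn.
rewrite xE lE path_eval_cat mulgA; apply: (path_eltM (v := w)).
  by exists k0, p.
(* The power [k], a multiple of the label, slides back across [d] and joins [k'] at [w]. *)
exists (dlam lam d * j + k')%R, s; split=> //.
  by move: ws; rewrite d'E /dtgt /= negbK -/(dsrc d) dw.
rewrite /= d'E dart_eval_rev !mulgA; congr (_ * _).
rewrite kE mulrC -(rep_dart gbs_is_rep) /dtgt /= negbK -/(dsrc d) mulgK.
by rewrite dw -gexpzD.
Qed.

End GBSGroup.

(** * The affine representation and the modular homomorphism *)

Section AffineRepresentation.
Variables (Gamma : graph) (lam : bool -> edge Gamma -> int) (F : fieldType).
Hypothesis lamF : forall s e, (lam s e)%:~R%R != 0%R :> F.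

Lemma affine_ratioP e :
  ((lam true e)%:~R / (lam false e)%:~R)%R \is a @GRing.unit F.
Proof. by rewrite unitfE mulf_neq0 ?invr_neq0. Qed.

Definition affine_vertex (v : vertex Gamma) : affine F := (1%R, 1).
Definition affine_edge e : affine F :=
  (0%R, exist (fun u : F => u \is a GRing.unit) _ (affine_ratioP e)).

Lemma affine_rep : is_rep lam affine_vertex affine_edge.
Proof.
move=> e; rewrite !sd_gexpz1 !affine_mulE /=; congr (_, _).
  by rewrite mulr0 addr0 add0r mulrVK // unitfE.
by rewrite mul1g mulg1.
Qed.

End AffineRepresentation.

Lemma units_neq0 (F : fieldType) (u : units F) : val u != 0%R.
Proof. by rewrite -unitfE; apply: (valP u). Qed.

Lemma affine_conj (F : fieldType) (t : F) (x : affine F) :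
  ((t, 1) : affine F) ^ x = (((val x.2)^-1 * t)%R, 1).
Proof.
apply: (mulgI x); rewrite conjgE mulVKg !affine_mulE /=; congr (_, _).
  by rewrite mul1r mulrA mulrV ?mul1r 1?addrC //; apply: (valP x.2).
by rewrite mulg1 mul1g.
Qed.

Section BasedHom.
Variables (Gamma : graph) (lam : bool -> edge Gamma -> int).
Variables (VT : {set vertex Gamma}) (ET : {set edge Gamma}).
Hypotheses (conG : connected_graph Gamma) (maxT : maximal_subtree VT ET).
Local Notation V := (vertex Gamma).
Local Notation E := (edge Gamma).
Local Notation G := (gbs_group lam ET).
Local Notation gvertex := (gbs_vertex lam ET).
Local Notation gedge := (gbs_edge lam ET).

Definition based_eval (K : groupType) (a : V -> K) (b : E -> K) v0 k0 l : K :=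
  gexpz (a v0) k0 * path_eval a b l.

Lemma based_hom (v0 : V) (K : groupType) (a : V -> K) (b : E -> K) :
  is_rep lam a b -> exists f : G -> K, {morph f : x y / x * y} /\
    forall k0 l, walk v0 (map fst l) v0 ->
      f (based_eval gvertex gedge v0 k0 l) = based_eval a b v0 k0 l.
Proof.
move=> ab; have [f [tau [fM tau1 fa fb]]] := rep_hom maxT v0 ab.
exists f; split=> // k0 l wl; rewrite fM (morph_gexpz fM) fa.
by rewrite (rep_hom_path fM fa fb wl) tau1 invg1 !mul1g !mulg1.
Qed.

Lemma vertex_groupP (v : V) (y : G) :
  vertex_group v y -> exists j, y = gexpz (gvertex v) j.
Proof.
apply: (@smallest_sub _ _ _ (fun y => exists j, y = gexpz (gvertex v) j)).
  split=> [|x {}y [i ->] [j ->]]; first by exists 0%R.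
  by exists (i - j)%R; rewrite gexpzB.
by move=> _ ->; exists 1%R.
Qed.

Lemma vertex_group_gexpz (v : V) j : vertex_group v (gexpz (gvertex v) j : G).
Proof.
move=> B [sB genB]; have Bg : B (gvertex v) by apply: genB.
have X n : B (gvertex v ^+ n).
  by elim: n => [|n IH]; [exact: sB.1|rewrite expgS; apply: subgroupM].
by case: j => n; [apply: X | apply: subgroupV].
Qed.

(** Multiples of the label slide across a dart, so the exponents found for the rest of the path are
    multiplied by the two labels. *)
Lemma commensurator (lam0 : forall s e, lam s e != 0%R) u l v :
  walk u (map fst l) v -> exists m n : int, [/\ m != 0%R, n != 0%R &
    gexpz (gvertex u) m ^ path_eval gvertex gedge l = gexpz (gvertex v) n].
Proof.
elim: l u => [|[d k] l IH] u /=.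
  by move=> /eqP ->; exists 1%R, 1%R; rewrite conjg1.
move=> /andP[/eqP <- /IH[m [n [m0 n0 mn]]]].
exists (dlam lam d * m)%R, (dlam lam (drev d) * n)%R.
rewrite !mulf_neq0 ?lam0 //; split=> //.
rewrite !conjgM [_ ^ dart_eval _ _]conjgE (rep_dart (gbs_is_rep lam ET)) mulKg.
rewrite (conjgE _ (gexpz _ k)) gexpz_comm mulKg.
by rewrite [(_ * m)%R]mulrC [(_ * n)%R]mulrC !gexpzM -gexpzJ mn.
Qed.

End BasedHom.

Section ModularHom.
Variables (Gamma : graph) (lam : bool -> edge Gamma -> int).
Variables (VT : {set vertex Gamma}) (ET : {set edge Gamma}).
Hypotheses (conG : connected_graph Gamma) (maxT : maximal_subtree VT ET).
Hypothesis lam0 : forall s e, lam s e != 0%R.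
Local Notation V := (vertex Gamma).
Local Notation E := (edge Gamma).
Local Notation G := (gbs_group lam ET).
Local Notation gvertex := (gbs_vertex lam ET).
Local Notation gedge := (gbs_edge lam ET).

Lemma lam_rat s e : (lam s e)%:~R%R != 0%R :> rat.
Proof. by rewrite intr_eq0. Qed.

Variables (v0 : V) (Phi : G -> affine rat) (tau : V -> affine rat).
Hypothesis PhiM : {morph Phi : x y / x * y}.
Hypothesis tau0 : tau v0 = 1.
Hypothesis Phi_vertex :
  forall v, Phi (gvertex v) = tau v * affine_vertex rat v * (tau v)^-1.
Hypothesis Phi_edge : forall e, Phi (gedge e) =
  tau (endpt true e) * affine_edge lam_rat e * (tau (endpt false e))^-1.

Lemma Phi_vertexE v : Phi (gvertex v) = (val (tau v).2, 1).
Proof.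
rewrite Phi_vertex -[tau v in X in X * _]invgK -mulgA -conjgE affine_conj /=.
by rewrite invrK mulr1.
Qed.

Lemma Phi_gexpz v j : Phi (gexpz (gvertex v) j) = ((j%:~R * val (tau v).2)%R, 1).
Proof. by rewrite (morph_gexpz PhiM) Phi_vertexE sd_gexpz1 mulrzl. Qed.

Lemma Phi_based k0 l : walk v0 (map fst l) v0 ->
  Phi (based_eval gvertex gedge v0 k0 l) =
  based_eval (affine_vertex rat) (affine_edge lam_rat) v0 k0 l.
Proof.
move=> wl; rewrite PhiM (morph_gexpz PhiM) Phi_vertex.
by rewrite (rep_hom_path PhiM Phi_vertex Phi_edge wl) tau0 invg1 !mul1g !mulg1.
Qed.

(** [Phi] sends a non-unit elliptic element to a nonzero translation, which conjugation scales by
    the inverse of the linear part. *)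
Lemma modular_value_unique (x : G) q : modular_value x q -> q = (val (Phi x).2)^-1%R.
Proof.
move=> [a [m [n [[[v [y [h [/vertex_groupP[j ->] ->]]]] a1] m0 n0 mn ->]]]].
have [t Phia t0] : exists2 t : rat, Phi (gexpz (gvertex v) j ^ h) = (t, 1) & t != 0%R.
  rewrite (morph_gJ PhiM) Phi_gexpz affine_conj; eexists; first by [].
  rewrite !mulf_neq0 ?invr_neq0 ?units_neq0 // intr_eq0.
  by apply: contra_notN a1 => /eqP->; rewrite gexpz0 conj1g.
have := congr1 Phi mn; rewrite (morph_gJ PhiM) !(morph_gexpz PhiM) Phia.
rewrite !sd_gexpz1 affine_conj => /(congr1 fst) /=.
rewrite -(mulrzl t m) -(mulrzl t n) mulrA => /(mulIf t0) e.
by rewrite -e mulfK // intr_eq0.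
Qed.

Lemma modular_value_exists (x : G) : exists q, modular_value x q.
Proof.
have [k0 [l [wl _ xE]]] := reduced_path conG maxT v0 x.
have [m [n [m0 n0 mn]]] := commensurator ET lam0 wl.
exists (n%:Q / m%:Q)%R, (gvertex v0), m, n; split=> //.
  split.
    by exists v0, (gvertex v0), 1; rewrite conjg1; split=> //;
      exact: (@vertex_group_gexpz _ lam ET v0 1%R).
  move=> /(congr1 Phi); rewrite Phi_vertexE (morph_g1 PhiM) => /(congr1 fst) /eqP /=.
  by rewrite (negPf (units_neq0 _)).
rewrite xE conjgM (conjgE _ (gexpz _ k0)) gexpz_comm mulKg; exact: mn.
Qed.

Lemma DeltaE (x : G) : Delta x = (val (Phi x).2)^-1%R.
Proof.
rewrite /Delta; case: xgetP => [q _ /modular_value_unique //|H].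
by have [q /H] := modular_value_exists x.
Qed.

End ModularHom.

(** * Reduction of the affine representation modulo primes *)

Section RationalReduction.
Variable F : fieldType.
Local Open Scope ring_scope.

(** A relation, because a rational can be reduced only when it has a denominator [d] that is nonzero
    in [F]. *)
Definition reduces_to (x : rat) (y : F) : Prop := exists n d : int,
  [/\ d%:~R != 0 :> F, x * d%:~R = n%:~R & y * d%:~R = n%:~R].

Lemma reduces_int (k : int) : reduces_to k%:~R k%:~R.
Proof. by exists k, 1; rewrite !mulr1 oner_neq0. Qed.

Lemma reduces_D x y x' y' : reduces_to x y -> reduces_to x' y' ->
  reduces_to (x + x') (y + y').
Proof.
move=> [n [d [d0 xd yd]]] [n' [d' [d0' xd' yd']]].
exists (n * d' + n' * d), (d * d'); rewrite !intrM mulf_neq0 //.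
by rewrite !intrD !intrM -xd -yd -xd' -yd'; split=> //; ring.
Qed.

Lemma reduces_M x y x' y' : reduces_to x y -> reduces_to x' y' ->
  reduces_to (x * x') (y * y').
Proof.
move=> [n [d [d0 xd yd]]] [n' [d' [d0' xd' yd']]].
exists (n * n'), (d * d'); rewrite !intrM mulf_neq0 //.
by rewrite -xd -yd -xd' -yd'; split=> //; ring.
Qed.

Lemma reduces_V x y : x != 0 -> y != 0 -> reduces_to x y ->
  reduces_to x^-1 y^-1.
Proof.
move=> x0 y0 [n [d [d0 xd yd]]]; exists d, n; split.
- by rewrite -yd mulf_neq0.
- by rewrite -xd mulKf.
- by rewrite -yd mulKf.
Qed.

Lemma reduces_neq0 x y : reduces_to x y ->
  (numq x)%:~R != 0 :> F -> (denq x)%:~R != 0 :> F -> y != 0.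
Proof.
move=> [n [d [d0 xd yd]]] nx dx.
have e : (n * denq x = numq x * d)%R.
  apply: (@intr_inj rat); rewrite !intrM -xd -{1}(divq_num_den x).
  by rewrite mulrAC mulfVK ?intr_eq0 ?denq_neq0.
apply: contraNneq nx => y0; apply/eqP/(mulIf d0).
by rewrite mul0r -intrM -e intrM -yd y0 !mul0r.
Qed.

End RationalReduction.

Lemma Fp_int_neq0 p (k : int) : prime p -> k != 0%R -> (`|k| < p)%N ->
  k%:~R%R != 0%R :> 'F_p.
Proof.
move=> pp k0 kp.
have N n : (0 < n < p)%N -> n%:R%R != 0%R :> 'F_p.
  move=> /andP[n0 np]; rewrite -(dvdn_pcharf (pchar_Fp pp)) gtnNdvd //.
case: k k0 kp => n; first by move=> n0 np; apply: N; rewrite np andbT lt0n.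
by move=> _ np; rewrite NegzE mulrNz oppr_eq0; apply: N.
Qed.

Section Separation.
Variables (Gamma : graph) (lam : bool -> edge Gamma -> int).
Variables (VT : {set vertex Gamma}) (ET : {set edge Gamma}).
Hypotheses (conG : connected_graph Gamma) (maxT : maximal_subtree VT ET).
Hypothesis lam0 : forall s e, lam s e != 0%R.
Local Notation V := (vertex Gamma).
Local Notation E := (edge Gamma).
Local Notation G := (gbs_group lam ET).
Local Notation gvertex := (gbs_vertex lam ET).
Local Notation gedge := (gbs_edge lam ET).
Local Notation aQ := (affine_vertex rat).
Local Notation bQ := (affine_edge (lam_rat lam0)).

Definition separated (x : G) : Prop := exists (K : groupType) (f : G -> K),
  [/\ {morph f : x y / x * y}, finite_set [set: K]%classic,
      solvable_group K & f x <> 1].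

Definition affine_reduces (F : fieldType) (x : affine rat) (y : affine F) : Prop :=
  reduces_to x.1 y.1 /\ reduces_to (val x.2) (val y.2).

Lemma affine_reducesM (F : fieldType) x x' (y y' : affine F) :
  affine_reduces x y -> affine_reduces x' y' -> affine_reduces (x * x') (y * y').
Proof.
move=> [x1 x2] [x1' x2']; rewrite !affine_mulE; split=> /=.
  exact/reduces_D/reduces_M.
exact/reduces_M.
Qed.

Lemma affine_reducesV (F : fieldType) x (y : affine F) :
  affine_reduces x y -> affine_reduces x^-1 y^-1.
Proof.
move=> [x1 x2]; have r2 : reduces_to (val x.2)^-1%R (val y.2)^-1%R.
  by apply: reduces_V x2; apply: units_neq0.
split=> //=.
rewrite -[(- _)%R]mulN1r -[(- (_ * y.1))%R]mulN1r.
by apply: reduces_M; [apply: (reduces_int _ (- 1)) | apply: reduces_M].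
Qed.

Lemma affine_path_reduces (F : fieldType)
    (lamF : forall s e, (lam s e)%:~R%R != 0%R :> F) v0 k0 l :
  affine_reduces (based_eval aQ bQ v0 k0 l)
    (based_eval (affine_vertex F) (affine_edge lamF) v0 k0 l).
Proof.
have tr k : affine_reduces (gexpz ((1%R, 1) : affine rat) k)
                           (gexpz ((1%R, 1) : affine F) k).
  rewrite !sd_gexpz1; split; last exact: (reduces_int _ 1).
  exact: reduces_int.
apply: affine_reducesM; first exact: tr.
elim: l => [|[d k] l IH] /=.
  by split; [apply: (reduces_int _ 0) | apply: (reduces_int _ 1)].
do 2 (apply: affine_reducesM => //).
have b e : affine_reduces (bQ e) (affine_edge lamF e).
  split; first exact: (reduces_int _ 0).
  apply: reduces_M; first exact: reduces_int.
  by apply: reduces_V; [apply: lam_rat | | apply: reduces_int].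
by rewrite /dart_eval; case: d.1 => //; apply: affine_reducesV.
Qed.

Lemma affine_separated v0 k0 l : walk v0 (map fst l) v0 ->
  based_eval aQ bQ v0 k0 l <> 1 ->
  separated (based_eval gvertex gedge v0 k0 l).
Proof.
move=> wl; set x := based_eval aQ bQ v0 k0 l => x1.
(* [z] is the translation part of [x] or its linear part minus 1; it is enough that [z] stays
   nonzero in the reduction. *)
have [z z0 zP] : exists2 z : rat, z != 0%R & forall (F : fieldType) (y : affine F),
    affine_reduces x y -> (numq z)%:~R%R != 0%R :> F ->
    (denq z)%:~R%R != 0%R :> F -> y <> 1.
  have [x10|x10] := eqVneq x.1 0%R; last first.
    exists x.1 => // F y [r _] nz dz y1.
    by have := reduces_neq0 r nz dz; rewrite y1 eqxx.
  exists (val x.2 - 1)%R.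
    rewrite subr_eq0; apply: contra_notN x1 => /eqP x21.
    case: x x10 x21 => x1 x2 /= -> x21; congr (_, _); exact/val_inj.
  move=> F y [_ r] nz dz y1.
  have r' : reduces_to (val x.2 - 1) (val y.2 - 1).
    by apply: reduces_D r (reduces_int _ (-1)).
  by have := reduces_neq0 r' nz dz; rewrite y1 subrr eqxx.
(* A prime above [B] divides no label, nor the numerator or denominator of [z]. *)
pose B := (`|numq z| + `|denq z| + \sum_e (`|lam true e| + `|lam false e|))%N.
have [p Bp pp] := prime_above B.
have lamp s e : (`|lam s e| < p)%N.
  apply: leq_ltn_trans Bp; rewrite /B (bigD1 e) //= addnA.
  apply: leq_trans (leq_addr _ _); rewrite addnA.
  by case: s; rewrite ?leq_addl // addnAC leq_addl.
have lamF s e : (lam s e)%:~R%R != 0%R :> 'F_p by apply: Fp_int_neq0.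
have [f [fM fE]] := based_hom maxT v0 (affine_rep lamF).
exists (affine 'F_p), f; split=> //.
- exact: affine_finite.
- exact: affine_solvable.
rewrite fE //; apply: zP; first exact: affine_path_reduces.
  apply: Fp_int_neq0 => //; first by rewrite numq_eq0.
  by apply: leq_ltn_trans Bp; rewrite /B -addnA leq_addr.
apply: Fp_int_neq0; rewrite ?denq_neq0 //.
by apply: leq_ltn_trans Bp; rewrite /B addnAC leq_addl.
Qed.

End Separation.

(** * The unimodular case *)

Lemma Zp_int_eq0 M (k : int) : (1 < M)%N -> k%:~R%R = 0%R :> 'Z_M ->
  (M%:Z %| k)%Z.
Proof.
move=> M1; suff N n : n%:R%R = 0%R :> 'Z_M -> (M %| n)%N.
  case: k => n; first by move/N.
  by rewrite NegzE mulrNz => /eqP; rewrite oppr_eq0 dvdzE /= => /eqP/N.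
by rewrite Zp_nat => /(congr1 val) /= /eqP; rewrite Zp_cast.
Qed.

Lemma wreath_faithful Gamma (lam : bool -> edge Gamma -> int) (K : groupType)
    (C : zmodType) (a : vertex Gamma -> K) :
  faithful_labels lam a -> faithful_labels lam (wreath_vertex C a).
Proof. by move=> fa s e m; rewrite sd_gexpz0 => /(congr1 snd)/fa. Qed.

Lemma common_denominator (I : finType) (w : I -> rat) :
  exists2 D : int, D != 0%R &
  exists W : I -> int, forall i, (W i)%:~R%R = (D%:~R * w i)%R.
Proof.
exists (\prod_i denq (w i))%R.
  by apply/prodf_neq0 => i _; rewrite denq_neq0.
suff /choice[W WE] : forall i, exists W : int,
    W%:~R%R = ((\prod_j denq (w j))%:~R * w i)%R by exists W.
move=> i.
exists (numq (w i) * \prod_(j | j != i) denq (w j))%R.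
rewrite [in RHS](bigD1 i) //= !intrM mulrAC; congr (_ * _)%R.
by rewrite mulrC -{2}(divq_num_den (w i)) mulfVK // intr_eq0 denq_neq0.
Qed.

Section Unimodular.
Variables (Gamma : graph) (lam : bool -> edge Gamma -> int).
Variables (VT : {set vertex Gamma}) (ET : {set edge Gamma}).
Hypotheses (conG : connected_graph Gamma) (maxT : maximal_subtree VT ET).
Hypothesis lam0 : forall s e, lam s e != 0%R.
Local Notation V := (vertex Gamma).
Local Notation E := (edge Gamma).
Local Notation G := (gbs_group lam ET).
Local Notation gvertex := (gbs_vertex lam ET).
Local Notation gedge := (gbs_edge lam ET).

Definition finite_solvable_rep (K : groupType) (a : V -> K) (b : E -> K) : Prop :=
  [/\ is_rep lam a b, faithful_labels lam a, finite_set [set: K]%classic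
    & solvable_group K].

Lemma dihedral_rep (W : V -> int) (sg : E -> bool) :
  (forall v, W v != 0%R) ->
  (forall e, W (endpt true e) * lam true e =
             (-1) ^+ sg e * (W (endpt false e) * lam false e))%R ->
  exists (K : groupType) (a : V -> K) (b : E -> K), finite_solvable_rep a b.
Proof.
move=> W0 WE.
(* [M] is a multiple of every [W (endpt s e) * lam s e], which makes the labels faithful; the factor
   2 ensures [1 < M]. *)
pose M := (2 * (\prod_v `|W v| * \prod_e (`|lam true e| * `|lam false e|)))%N.
have M1 : (1 < M)%N.
  rewrite /M mul2n -addnn; apply: (@leq_add 1 1).
    rewrite muln_gt0 !prodn_gt0 // => i; rewrite ?muln_gt0 !absz_gt0 ?lam0 //.
  by rewrite muln_gt0 !prodn_gt0 // => i; rewrite ?muln_gt0 !absz_gt0 ?lam0.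
have u_unit e : ((-1) ^+ sg e)%R \is a @GRing.unit 'Z_M by rewrite unitrX ?unitrN1.
pose a v : affine 'Z_M := ((W v)%:~R%R, 1).
pose b e : affine 'Z_M :=
  (0%R, exist (fun u : 'Z_M => u \is a GRing.unit) _ (u_unit e)).
exists (affine 'Z_M), a, b; split.
- move=> e; rewrite !sd_gexpz1 !affine_mulE /=.
  congr (_, _); last by rewrite mul1g mulg1.
  rewrite mulr0 addr0 add0r -!mulrzA WE intrM; congr (_ * _)%R.
  by case: (sg e).
- move=> s e m; rewrite sd_gexpz1 => /(congr1 fst) /=; rewrite -mulrzA.
  move=> /(Zp_int_eq0 M1) dM.
  have : ((W (endpt s e) * lam s e)%R %| (W (endpt s e) * m)%R)%Z.
    apply: dvdz_trans dM; rewrite dvdzE abszM; apply: dvdn_mull.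
    apply: dvdn_mul; first by rewrite (bigD1 (endpt s e)) //= dvdn_mulr.
    rewrite (bigD1 e) //=; apply: dvdn_mulr.
    by case: s; [apply: dvdn_mulr | apply: dvdn_mull].
  by rewrite dvdz_mul2l.
- exact: affine_finite.
- exact: affine_solvable.
Qed.

Lemma finite_solvable_rep_wreath (K : groupType) (a : V -> K) (b : E -> K) e q :
  finite_solvable_rep a b ->
  finite_solvable_rep (wreath_vertex 'F_2 a)
    (wreath_edge b (edge_indicator lam 'F_2 a e q)).
Proof.
move=> [ab fa fK sK]; split.
- exact/wreath_rep/edge_indicator_function.
- exact: wreath_faithful.
- exact: wreath_finite.
- exact: semidirect_solvable.
Qed.

Lemma based_eval_separated (K : groupType) (a : V -> K) (b : E -> K) v0 k0 l :
  finite_solvable_rep a b -> walk v0 (map fst l) v0 -> reduced lam l ->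
  based_eval gvertex gedge v0 k0 l <> 1 ->
  separated (based_eval gvertex gedge v0 k0 l).
Proof.
move=> R wl red x1.
(* [detects] says nothing about an empty path; a vertex power is separated by the affine
   representation. *)
have [l0|l0] := eqVneq l [::].
  apply: (affine_separated maxT (lam0 := lam0)) => //.
  rewrite l0 /based_eval /= mulg1 sd_gexpz1.
  move=> /(congr1 fst) /= /eqP; rewrite intr_eq0 => /eqP k0E.
  by apply: x1; rewrite l0 k0E /based_eval /= mulg1.
have [|K' [a' [b' [[ab' _ fK sK] D _]]]] :=
  exists_detecting (P := finite_solvable_rep) _ finite_solvable_rep_wreath red R.
  by move=> ? ? ? [].
have [f [fM fE]] := based_hom maxT v0 ab'.
exists K', f; split=> //; rewrite fE // => e.
apply: (D [::] l [::] v0 _ l0 wl (- k0)%R); first by rewrite cats0.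
by rewrite gexpzN; apply: (mulgI (gexpz (a' v0) k0)); rewrite mulgV.
Qed.

Variables (v0 : V) (Phi : G -> affine rat) (tau : V -> affine rat).
Hypothesis PhiM : {morph Phi : x y / x * y}.
Hypothesis tau0 : tau v0 = 1.
Hypothesis Phi_vertex :
  forall v, Phi (gvertex v) = tau v * affine_vertex rat v * (tau v)^-1.
Hypothesis Phi_edge : forall e, Phi (gedge e) =
  tau (endpt true e) * affine_edge (lam_rat lam0) e * (tau (endpt false e))^-1.

Lemma unimodular_separated :
  (forall x, val (Phi x).2 = 1%R \/ val (Phi x).2 = (-1)%R) ->
  forall x : G, x <> 1 -> separated x.
Proof.
(* By [Phi_vertexE], [w v] is the translation part of the image of the generator at [v]. Up to sign
   these satisfy the edge relations, and a common denominator makes them integral. *)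
move=> uni x x1; pose w v := val (tau v).2.
have w0 v : w v != 0%R by apply: units_neq0.
have [D D0 [W WE]] := common_denominator w.
have sgP e : exists sg : bool, (w (endpt true e) * (lam true e)%:~R =
    (-1) ^+ sg * (w (endpt false e) * (lam false e)%:~R))%R.
  have l0 : (lam false e)%:~R%R != 0%R :> rat by rewrite intr_eq0.
  have key s : val (Phi (gedge e)).2 = ((-1) ^+ s)%R ->
    (w (endpt true e) * (lam true e)%:~R =
     (-1) ^+ s * (w (endpt false e) * (lam false e)%:~R))%R.
    move=> <-; rewrite Phi_edge !affine_mulE /= -/(w _) -/(w _).
    by field; rewrite l0 w0.
  by case: (uni (gedge e)) => u; [exists false|exists true]; apply: key.
have [sg sgE] := choice sgP.
have [|e|K [a [b R]]] := @dihedral_rep W sg.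
- by move=> v; rewrite -(intr_eq0 rat) WE mulf_neq0 // intr_eq0.
- apply: (@intr_inj rat); rewrite !intrM !WE -mulrA sgE; set s := ((-1) ^+ _)%R.
  have -> : (((-1) ^+ sg e)%:~R = s :> rat)%R by rewrite /s; case: (sg e).
  by ring.
have [k0 [l [wl red xE]]] := reduced_path conG maxT v0 x.
rewrite xE; apply: (based_eval_separated R) => //.
by move=> x1'; apply: x1; rewrite xE.
Qed.

End Unimodular.

(** * The kernel of the affine representation *)

Lemma wreath_conj (K : groupType) (C : zmodType) (x y : wreath K C) z :
  x.2 = 1 -> (x ^ y).1 z = x.1 (z * y.2^-1).
Proof.
move=> x2; rewrite conjgE !wreath_fstM wreath_fstV.
by rewrite [(y^-1).2]/= x2 mulg1 addrCA addNr addr0.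
Qed.

Lemma geometric_integral (y d : rat) : y != 0%R ->
  (forall k : nat, exists j : int, y * d ^+ k = j%:~R)%R -> denq d = 1%R.
Proof.
move=> y0 H; have [j0] := H 0%N; rewrite expr0 mulr1 => yj0.
have dvd k : (denq d ^+ k %| j0)%Z.
  have [j] := H k; rewrite yj0 -{1}(divq_num_den d) expr_div_n mulrA => e.
  have e' : (j0 * numq d ^+ k = j * denq d ^+ k)%R.
    apply: (@intr_inj rat); rewrite !intrM !rmorphXn /= -e mulfVK //.
    by rewrite expf_neq0 // intr_eq0 denq_neq0.
  rewrite -(Gauss_dvdzl _ (p := (numq d ^+ k)%R)) ?e' ?dvdz_mull //.
  rewrite coprimezXl // coprimezXr // coprimez_sym; exact: coprime_num_den.
have j00 : j0 != 0%R by rewrite -(intr_eq0 rat) -yj0.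
apply/eqP; apply: contraT => d1.
have d2 : (1 < `|denq d|)%N.
  by case: (denq d) (denq_gt0 d) d1 => // -[|[|n]].
(* The exponent [|j0|] suffices, as an integer above 1 raised to it exceeds [|j0|]. *)
have /= := dvd `|j0|%N; rewrite dvdzE abszX => /dvdn_leq.
rewrite absz_gt0 j00 => /(_ isT); rewrite leqNgt => /negP[].
exact: ltn_expl.
Qed.

(** * Counting crossings on one half of an infinite cyclic cover *)

Section StepFunction.
Variables (Gamma : graph) (lam : bool -> edge Gamma -> int).
Local Notation V := (vertex Gamma).
Local Notation E := (edge Gamma).
Variables (K : groupType) (a : V -> K) (b : E -> K).
Variables (F : E -> K -> int) (z0 z1 : K).
Hypothesis Ff : edge_function lam a F.
Local Notation W := (wreath K int).
Local Notation wa := (wreath_vertex int a).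
Local Notation wb := (wreath_edge b F).

(* The second coordinate [w.1 z0] of the right [W]-set [K * int] lists the
   sheets of the infinite cyclic cover cut along the edges counted by [F]; the
   function below counts the same edges, translated, but only on the sheets of
   nonnegative index. *)
Definition step_function (e : E) (w : W) : int :=
  if (0 <= w.1 z0)%R then F e (z1 * w.2) else 0%R.

Lemma step_edge_function : edge_function lam wa step_function.
Proof.
move=> e w; rewrite /step_function sd_gexpz0 wreath_fstM addr0.
by rewrite [(w * _).2]/= mulgA Ff.
Qed.

Local Notation W2 := (wreath W int).
Local Notation wwa := (wreath_vertex int wa).
Local Notation wwb := (wreath_edge wb step_function).

(** Right multiplication changes [w.1 z0] by an amount depending only on [w.2], and [step_function]
    reads nothing else. *)
Lemma step_local v0 k0 l (w w' : W) : w.1 z0 = w'.1 z0 -> w.2 = w'.2 ->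
  (based_eval wwa wwb v0 k0 l).1 w = (based_eval wwa wwb v0 k0 l).1 w'.
Proof.
move=> w1 w2; rewrite /based_eval sd_gexpz0 !wreath_fstM.
congr (_ + _)%R; have : (w * gexpz (wa v0) k0).2 = (w' * gexpz (wa v0) k0).2.
  by rewrite /= w2.
have : (w * gexpz (wa v0) k0).1 z0 = (w' * gexpz (wa v0) k0).1 z0.
  by rewrite !wreath_fstM w1 w2.
move: (w * _) (w' * _) => {w1 w2} {}w {}w'.
elim: l w w' => [//|[d k] l IH] w w' w1 w2; rewrite !wreath_eval_cons.
congr (_ + _)%R; last by apply: IH; rewrite ?wreath_fstM /= w2 ?w1.
by rewrite /crossing /step_function !wreath_fstM /= w1 w2.
Qed.

(** For fixed [w.2] the path shifts the sheet by bounded amounts, so from high enough it only meets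
    nonnegative sheets, where [F] translated by [z1] is counted. *)
Lemma step_high v0 k0 l (k : K) : exists L : int, forall w : W,
  w.2 = k -> (L <= w.1 z0)%R ->
  (based_eval wwa wwb v0 k0 l).1 w = (based_eval wa wb v0 k0 l).1 (z1 * k).
Proof.
have H : forall k : K, exists L : int, forall w : W, w.2 = k -> (L <= w.1 z0)%R ->
    (path_eval wwa wwb l).1 w = (path_eval wa wb l).1 (z1 * k).
  elim: l => [|[d j] l IH] {}k; first by exists 0%R.
  have [L LP] := IH (k * (dart_eval b d * gexpz (a (dtgt d)) j)).
  (* [s] is the sheet shift of the first entry; [s'] is what a reversed dart subtracts from the
     sheet before it is read. *)
  pose s := ((dart_eval wb d * gexpz (wa (dtgt d)) j) : W).1 (z0 * k).
  pose s' := F d.2 (z0 * k * (b d.2)^-1).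
  exists (Num.max (L - s) (Num.max 0 s'))%R => w wk.
  rewrite !ge_max => /andP[wL /andP[w0 ws]].
  rewrite !wreath_eval_cons LP.
  - rewrite mulgA; congr (_ + _)%R; rewrite /crossing /step_function.
    case: d.1; first by rewrite w0 wk.
    rewrite wreath_fstM wreath_fstV wk.
    by rewrite [(w * _).2]/= wk mulgA subr_ge0 ws.
  - rewrite /= wk; congr (_ * (_ * _)); last by rewrite sd_gexpz0.
    by rewrite wreath_dart_eval.
  - by rewrite wreath_fstM wk -lerBlDr.
have [L LP] := H (k * gexpz (a v0) k0).
exists L => w wk wL; rewrite /based_eval !sd_gexpz0 !wreath_fstM !add0r.
rewrite LP ?mulgA //; first by rewrite /= wk.
by rewrite wreath_fstM addr0.
Qed.

Lemma step_low v0 k0 l (k : K) : exists L : int, forall w : W,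
  w.2 = k -> (w.1 z0 <= L)%R -> (based_eval wwa wwb v0 k0 l).1 w = 0%R.
Proof.
have H : forall k : K, exists L : int, forall w : W, w.2 = k -> (w.1 z0 <= L)%R ->
    (path_eval wwa wwb l).1 w = 0%R.
  elim: l => [|[d j] l IH] {}k; first by exists 0%R.
  have [L LP] := IH (k * (dart_eval b d * gexpz (a (dtgt d)) j)).
  pose s := ((dart_eval wb d * gexpz (wa (dtgt d)) j) : W).1 (z0 * k).
  pose s' := F d.2 (z0 * k * (b d.2)^-1).
  (* The bounds [- 1] and [s' - 1] keep the index strictly negative for a forward and a reversed
     dart. *)
  exists (Num.min (L - s) (Num.min (- 1) (s' - 1)))%R => w wk.
  rewrite !le_min => /andP[wL /andP[w0 ws]].
  rewrite !wreath_eval_cons LP.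
  - rewrite addr0 /crossing /step_function; case: d.1.
      by rewrite leNgt (le_lt_trans w0).
    rewrite wreath_fstM wreath_fstV wk leNgt subr_lt0.
    by rewrite (le_lt_trans ws) ?oppr0 // ltrBlDr ltrDl.
  - rewrite /= wk; congr (_ * (_ * _)); last by rewrite sd_gexpz0.
    by rewrite wreath_dart_eval.
  - by rewrite wreath_fstM wk -lerBrDr.
have [L LP] := H (k * gexpz (a v0) k0).
exists L => w wk wL; rewrite /based_eval !sd_gexpz0 !wreath_fstM !add0r.
rewrite LP //; first by rewrite /= wk.
by rewrite wreath_fstM addr0.
Qed.

End StepFunction.

Lemma denq_mul_int (x : rat) : ((denq x)%:~R * x)%R \is a Num.int.
Proof.
by rewrite mulrC -{1}(divq_num_den x) mulfVK ?intr_int // intr_eq0 denq_neq0.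
Qed.

(** * Denominators of cycles in covers above the affine representation *)

Section NonUnimodular.
Variables (Gamma : graph) (lam : bool -> edge Gamma -> int).
Variables (VT : {set vertex Gamma}) (ET : {set edge Gamma}).
Hypotheses (conG : connected_graph Gamma) (maxT : maximal_subtree VT ET).
Hypothesis lam0 : forall s e, lam s e != 0%R.
Local Notation V := (vertex Gamma).
Local Notation E := (edge Gamma).
Local Notation G := (gbs_group lam ET).
Local Notation gvertex := (gbs_vertex lam ET).
Local Notation gedge := (gbs_edge lam ET).
Local Notation aQ := (affine_vertex rat).
Local Notation bQ := (affine_edge (lam_rat lam0)).

Definition refines_affine (K : groupType) (a : V -> K) (b : E -> K)
    (pi : K -> affine rat) : Prop :=
  [/\ is_rep lam a b, {morph pi : x y / x * y}, forall v, pi (a v) = aQ v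
    & forall e, pi (b e) = bQ e].

Lemma refines_faithful (K : groupType) (a : V -> K) b pi :
  refines_affine a b pi -> faithful_labels lam a.
Proof.
move=> [_ piM pia _] s e m /(congr1 pi).
rewrite (morph_gexpz piM) pia (morph_g1 piM) sd_gexpz1 => /(congr1 fst) /= /eqP.
by rewrite intr_eq0 => /eqP->; rewrite dvdz0.
Qed.

(** The lift from [z] meets the chosen edge only if a shift of [z] lies in one coset of the edge
    group, where denominators are bounded; fixing the linear part [u] makes these shifts
    constant. *)
Lemma crossing_bounded (K : groupType) (a : V -> K) b pi e0 q l :
  refines_affine a b pi -> forall u : units rat,
  exists2 B : int, B != 0%R & forall z, (pi z).2 = u ->
    (path_eval (wreath_vertex int a)
       (wreath_edge b (edge_indicator lam int a e0 q)) l).1 z <> 0%R ->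
    (B%:~R * (pi z).1)%R \is a Num.int.
Proof.
move=> [ab piM pia pib]; elim: l => [|[d k] l IH] u; first by exists 1%R.
set y := dart_eval b d * gexpz (a (dtgt d)) k.
have [B' B'0 BP] := IH (u * (pi y).2).
(* [c] is the shift of the translation part made by the first entry. [D] clears denominators on the
   coset of [q], where the translation part is that of [q] plus an integral multiple of its linear
   part. *)
pose c := (val u * (pi y).1)%R.
pose D := (denq (pi q).1 * denq (val (pi q).2))%R.
have D0 : D != 0%R by rewrite mulf_neq0 ?denq_neq0.
exists (D * (B' * denq c))%R; first by rewrite !mulf_neq0 ?denq_neq0.
move=> z zu; rewrite wreath_eval_cons.
set X := crossing _ _ d z => XY.
have [X0|/eqP X0] := eqVneq X 0%R.
  have {}BP := BP (z * y).
  rewrite intrM -mulrA rpredM ?intr_int // intrM.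
  rewrite (_ : _ * _ = (denq c)%:~R * (B'%:~R * (pi (z * y)%g).1)
                      - B'%:~R * ((denq c)%:~R * c))%R.
    rewrite rpredB // rpredM ?intr_int // ?denq_mul_int //; apply: BP.
      by rewrite piM /= zu.
    by move=> Y0; apply: XY; rewrite X0 add0r.
  rewrite piM affine_mulE zu /= -/c; ring.
have ind z' : edge_indicator lam int a e0 q d.2 z' <> 0%R ->
    (D%:~R * (pi z').1)%R \is a Num.int.
  move=> /edge_indicatorP[_ [j ->]]; rewrite piM (morph_gexpz piM) pia.
  rewrite sd_gexpz1 affine_mulE /= -[sval _]/(val (pi q).2).
  set i := (lam true e0 * j)%R.
  have -> : D%:~R%R = ((denq (pi q).1)%:~R * (denq (val (pi q).2))%:~R)%R :> rat.
    exact: intrM.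
  rewrite (_ : _ * _ = (denq (val (pi q).2))%:~R * ((denq (pi q).1)%:~R * (pi q).1)
    + (denq (pi q).1)%:~R * ((denq (val (pi q).2))%:~R * val (pi q).2) *
      i%:~R)%R; last by ring.
  apply: rpredD; first exact: rpredM (intr_int _ _) (denq_mul_int _).
  exact: rpredM (rpredM (intr_int _ _) (denq_mul_int _)) (intr_int _ _).
rewrite intrM -mulrA mulrCA; apply: rpredM; first exact: intr_int.
move: X0; rewrite /X /crossing; case: d.1 => H; first exact: ind.
have -> : (pi z).1 = (pi (z * (b d.2)^-1)).1.
  by rewrite piM (morph_gV piM) pib affine_mulE /= mulr0 oppr0 mulr0 addr0.
by apply: ind => H'; apply: H; rewrite H' oppr0.
Qed.

End NonUnimodular.

Lemma translationV (F : fieldType) (y : F) :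
  ((y, 1) : affine F)^-1 = ((- y)%R, 1).
Proof. by rewrite sd_invE invg1; congr (_, _); rewrite /= mul1r. Qed.

Section ModularKernel.
Variables (Gamma : graph) (lam : bool -> edge Gamma -> int).
Variables (VT : {set vertex Gamma}) (ET : {set edge Gamma}).
Hypotheses (conG : connected_graph Gamma) (maxT : maximal_subtree VT ET).
Hypothesis lam0 : forall s e, lam s e != 0%R.
Local Notation V := (vertex Gamma).
Local Notation E := (edge Gamma).
Local Notation G := (gbs_group lam ET).
Local Notation gvertex := (gbs_vertex lam ET).
Local Notation gedge := (gbs_edge lam ET).
Local Notation aQ := (affine_vertex rat).
Local Notation bQ := (affine_edge (lam_rat lam0)).

Variables (v0 : V) (Phi : G -> affine rat) (tau : V -> affine rat).
Hypothesis PhiM : {morph Phi : x y / x * y}.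
Hypothesis tau0 : tau v0 = 1.
Hypothesis Phi_vertex :
  forall v, Phi (gvertex v) = tau v * aQ v * (tau v)^-1.
Hypothesis Phi_edge : forall e, Phi (gedge e) =
  tau (endpt true e) * bQ e * (tau (endpt false e))^-1.

Lemma Phi_v0 j : Phi (gexpz (gvertex v0) j) = (j%:~R%R, 1).
Proof.
by rewrite (Phi_gexpz PhiM Phi_vertex) tau0 /= mulr1.
Qed.

Lemma Phi_linX (t : G) k : val (Phi (t ^+ k)).2 = (val (Phi t).2 ^+ k)%R.
Proof.
elim: k => [|k IH]; first by rewrite (morph_g1 PhiM).
by rewrite expgS PhiM affine_mulE [LHS]/= IH exprS.
Qed.

Lemma Phi_powers (t : G) N k : let d := (val (Phi t).2)^-1%R in
  Phi (gexpz (gvertex v0) N ^ (t ^+ k)) = ((N%:~R * d ^+ k)%R, 1).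
Proof.
move=> d; rewrite (morph_gJ PhiM) Phi_v0 affine_conj Phi_linX -exprVn.
by rewrite mulrC.
Qed.

(* The support of the 1-cycle of [alpha] in the [K]-cover is finite modulo the
   edge groups, so it has bounded denominators in [affine rat], whereas those of
   [c_k = (g_v0 ^ N) ^ (t ^ k)] are unbounded. *)
Lemma kernel_cover (A : set G) (t alpha0 : G) :
  denq (val (Phi t).2)^-1%R <> 1%R ->
  (forall x, A x -> Phi x = 1) -> A alpha0 -> alpha0 <> 1 ->
  exists (K : groupType) (a : V -> K) (b : E -> K) (F : E -> K -> int)
    (f : G -> wreath K int) (alpha : G) (z : K),
  [/\ is_rep lam a b /\ edge_function lam a F,
      {morph f : x y / x * y} /\ (forall k0 l, walk v0 (map fst l) v0 ->
         f (based_eval gvertex gedge v0 k0 l) =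
         based_eval (wreath_vertex int a) (wreath_edge b F) v0 k0 l),
      (forall x, A x -> (f x).2 = 1) /\ A alpha,
      (f alpha).1 z <> 0%R &
      forall N, N != 0%R -> exists k,
        (f alpha).1 (z * (f (gexpz (gvertex v0) N ^ (t ^+ k))).2^-1) = 0%R].
Proof.
move=> dt AP A0 a01.
pose kills (K : groupType) (a : V -> K) (b : E -> K) := forall k0 l,
  walk v0 (map fst l) v0 -> A (based_eval gvertex gedge v0 k0 l) ->
  based_eval a b v0 k0 l = 1.
pose P (K : groupType) (a : V -> K) (b : E -> K) :=
  (exists pi, refines_affine lam0 a b pi) /\ kills K a b.
have wreath_refines (K : groupType) (a : V -> K) b pi F :
    refines_affine lam0 a b pi -> edge_function lam a F ->
    refines_affine lam0 (wreath_vertex int a) (wreath_edge b F)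
      (fun x : wreath K int => pi (x.2 : K)).
  move=> [ab piM pia pib] Ff; split; first exact: wreath_rep.
  - by move=> x y; rewrite -piM.
  - exact: pia.
  - exact: pib.
have [] := pselect (exists (K : groupType) (a : V -> K) (b : E -> K) e q k0 l z,
    [/\ P K a b, walk v0 (map fst l) v0, A (based_eval gvertex gedge v0 k0 l) &
    (based_eval (wreath_vertex int a)
      (wreath_edge b (edge_indicator lam int a e q)) v0 k0 l).1 z <> 0%R]); last first.
  (* Otherwise [A] dies at every stage of the tower, including the one that detects the reduced path
     of [alpha0]. *)
  move=> noK; exfalso.
  have PP (K : groupType) (a : V -> K) (b : E -> K) e q :
      P K a b ->
      P _ (wreath_vertex int a) (wreath_edge b (edge_indicator lam int a e q)).
    move=> Pab; have [[pi piP] kab] := Pab; split.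
      by exists (fun x : wreath K int => pi (x.2 : K));
      apply/wreath_refines/edge_indicator_function.
    move=> k0 l wl Al; set y := based_eval _ _ _ _ _.
    have y2 : y.2 = 1.
      rewrite -(kab k0 l wl Al) /y /based_eval sd_gexpz0 /=.
      by rewrite wreath_eval_snd.
    have y1 : y.1 = 0%R.
      apply/funext => z; apply: contrapT => yz; apply: noK.
      by exists K, a, b, e, q, k0, l, z.
    by case: y y1 y2 => /= ? ? -> ->.
  have [k0 [l [wl red xE]]] := reduced_path conG maxT v0 alpha0.
  have PQ : P _ aQ bQ.
    split; first by exists id; split=> //; apply: affine_rep.
    move=> k0' l' wl' Al'.
    by rewrite -(Phi_based PhiM tau0 Phi_vertex Phi_edge k0' wl') AP.
  have [l0|l0] := eqVneq l [::].
    have := AP _ A0; rewrite xE l0 /= mulg1 Phi_v0 => /(congr1 fst) /= /eqP.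
    rewrite intr_eq0 => /eqP k00; apply: a01.
    by rewrite xE l0 k00 /= mulg1.
  have [|K [a [b [[_ kab] D _]]]] := exists_detecting (P := P) _ PP red PQ.
    by move=> K a b [[pi piP] _]; split; [case: piP|apply: refines_faithful piP].
  rewrite xE in A0; have k1 := kab k0 l wl A0.
  apply: (D [::] l [::] v0 _ l0 wl (- k0)%R); first by rewrite cats0.
  by rewrite gexpzN; apply: (mulgI (gexpz (a v0) k0)); rewrite mulgV.
move=> [K [a [b [e [q [k0 [l [z [[[pi piP] kab] wl Al nz]]]]]]]]].
have [ab piM pia pib] := piP.
set F := edge_indicator lam int a e q in nz.
have Ff : edge_function lam a F by apply: edge_indicator_function.
have [f [fM fE]] := based_hom maxT v0 (wreath_rep ab Ff).
have f2 x : exists k1 l1, [/\ walk v0 (map fst l1) v0,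
     x = based_eval gvertex gedge v0 k1 l1 &
     (f x).2 = based_eval a b v0 k1 l1].
  have [k1 [l1 [wl1 _ xE]]] := reduced_path conG maxT v0 x.
  exists k1, l1; split=> //; rewrite xE fE // /based_eval sd_gexpz0 /=.
  by rewrite wreath_eval_snd.
have pif x : pi (f x).2 = Phi x.
  have [k1 [l1 [wl1 -> ->]]] := f2 x.
  rewrite (Phi_based PhiM tau0 Phi_vertex Phi_edge k1 wl1) piM (morph_gexpz piM) pia.
  by congr (_ * _); apply: morph_path_eval.
exists K, a, b, F, f, (based_eval gvertex gedge v0 k0 l), z; split=> //.
- split=> // x Ax; have [k1 [l1 [wl1 xE ->]]] := f2 x.
  by apply: kab => //; rewrite -xE.
- by rewrite fE.
(* If every [k] failed, the denominators of all [N * d ^+ k] would be bounded, making [d] an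
   integer. *)
move=> N N0; apply: contrapT => nok; apply: dt.
set d := (val (Phi t).2)^-1%R.
pose u := (pi z).2.
have [B B0 BP] := crossing_bounded e q l piP u.
pose x0 := ((pi z).1 + val u * k0%:~R)%R.
apply: (@geometric_integral ((denq x0 * B)%:~R * (val u * N%:~R))%R).
  by rewrite !mulf_neq0 ?intr_eq0 ?mulf_neq0 ?denq_neq0 ?units_neq0.
move=> k; apply/intrP.
set c := gexpz (gvertex v0) N ^ (t ^+ k).
have e1 : pi (z * (f c).2^-1 * gexpz (a v0) k0) =
    ((x0 - val u * (N%:~R * d ^+ k))%R, u).
  rewrite !piM (morph_gV piM) pif Phi_powers -/d translationV.
  rewrite (morph_gexpz piM) pia sd_gexpz1 !affine_mulE /= !mulg1.
  by congr (_, _); rewrite /x0 mulrN -/u mulr1 addrAC.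
have Bk : (B%:~R * (x0 - val u * (N%:~R * d ^+ k)))%R \is a Num.int.
  have := BP (z * (f c).2^-1 * gexpz (a v0) k0); rewrite e1; apply=> // nz'.
  apply: nok; exists k; rewrite fE // /based_eval sd_gexpz0 wreath_fstM nz'.
  by rewrite addr0.
have dx0 := denq_mul_int x0.
rewrite (_ : _ * d ^+ k = B%:~R * ((denq x0)%:~R * x0) -
  (denq x0)%:~R * (B%:~R * (x0 - val u * (N%:~R * d ^+ k))))%R.
  by apply: rpredB; apply: rpredM => //; apply: intr_int.
by rewrite intrM; ring.
Qed.

End ModularKernel.

(* Conjugation by [s] matches the subgroups of index [m] and [n] prime to each
   other, so the order of [b] is prime to both. *)
Lemma finite_coprime_conj (H : groupType) (b s : H) (m n : int) :
  finite_set [set: H]%classic -> coprimez m n -> gexpz b m ^ s = gexpz b n ->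
  exists j, b ^ s = gexpz b j.
Proof.
move=> fH mn bs.
have exr : exists r, (0 < r)%N && (b ^+ r == 1).
  by have [r r0 br] := finite_order b fH; exists r; rewrite r0 br eqxx.
have [r /andP[r0 /eqP br] minr] := ex_minnP exr.
have bqr q : gexpz b (q * r%:Z) = 1.
  by rewrite mulrC gexpzM /= br; case: q => i; rewrite /gexpz expg1n ?invg1.
have rP (j : int) : gexpz b j = 1 -> (r%:Z %| j)%Z.
  rewrite {1}(divz_eq j r%:Z) gexpzD bqr mul1g => bj.
  apply/dvdz_mod0P; have := ltz_pmod j (r0 : 0 < r%:Z)%R.
  have : (0 <= j %% r%:Z)%Z%R by rewrite modz_ge0 // -lt0n.
  case: (j %% r%:Z)%Z bj => // -[//|i] bi _ ir.
  have := minr i.+1; rewrite (bi : b ^+ i.+1 = 1) eqxx => /(_ isT).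
  by rewrite leqNgt -ltz_nat ir.
(* With [e] the gcd of [r] and [m], [b] to the power [m * (r / e)] is 1; conjugating, so is its
   power [n * (r / e)]. Hence [e] divides [n] as well as [m]. *)
have com : coprimez r m.
  set e := gcdz r m; have er : (r%:Z = (r %/ e)%Z * e)%R by rewrite divzK ?dvdz_gcdl.
  have em : (m = (m %/ e)%Z * e)%R by rewrite divzK ?dvdz_gcdr.
  have r'0 : (r %/ e)%Z != 0%R.
    by apply: contraTneq r0 => r'0; rewrite -ltz_nat er r'0 mul0r.
  have bm1 : gexpz b (m * (r %/ e)%Z) = 1.
    by rewrite em mulrAC -mulrA -er bqr.
  have bn1 : gexpz b (n * (r %/ e)%Z) = 1.
    by rewrite gexpzM -bs gexpzJ -gexpzM bm1 conj1g.
  have en : (e %| n)%Z.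
    by move: (rP _ bn1); rewrite [X in (X %| _)%Z]er [(_ * e)%R]mulrC dvdz_mul2r.
  have : (e %| gcdz m n)%Z by rewrite dvdz_gcd en dvdz_gcdr.
  by rewrite (eqP mn) dvdz1.
have /coprimezP[[u v] uv] := com.
(* Modulo the order [r], [v] inverts [m], so [b] is the [v]-th power of [gexpz b m]. *)
exists (n * v)%R; rewrite gexpzM -bs gexpzJ -gexpzM; congr (_ ^ s).
have e : (m * v = 1 - u * r%:Z)%R by rewrite -uv /= addrC addKr mulrC.
by rewrite e gexpzB bqr invg1 mulg1.
Qed.

(** * Triviality of the kernel under residual finiteness or solvability *)

Section KernelTrivial.
Variables (Gamma : graph) (lam : bool -> edge Gamma -> int).
Variables (VT : {set vertex Gamma}) (ET : {set edge Gamma}).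
Hypotheses (conG : connected_graph Gamma) (maxT : maximal_subtree VT ET).
Hypothesis lam0 : forall s e, lam s e != 0%R.
Local Notation V := (vertex Gamma).
Local Notation E := (edge Gamma).
Local Notation G := (gbs_group lam ET).
Local Notation gvertex := (gbs_vertex lam ET).
Local Notation gedge := (gbs_edge lam ET).
Local Notation aQ := (affine_vertex rat).
Local Notation bQ := (affine_edge (lam_rat lam0)).

Variables (v0 : V) (Phi : G -> affine rat) (tau : V -> affine rat).
Hypothesis PhiM : {morph Phi : x y / x * y}.
Hypothesis tau0 : tau v0 = 1.
Hypothesis Phi_vertex :
  forall v, Phi (gvertex v) = tau v * aQ v * (tau v)^-1.
Hypothesis Phi_edge : forall e, Phi (gedge e) =
  tau (endpt true e) * bQ e * (tau (endpt false e))^-1.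
Variable t : G.
Hypothesis denq_t : denq (val (Phi t).2)^-1%R <> 1%R.

Lemma commensurator_v0 (x : G) : exists m n : int, [/\ m != 0%R, n != 0%R &
  gexpz (gvertex v0) m ^ x = gexpz (gvertex v0) n].
Proof.
have [k0 [l [wl _ ->]]] := reduced_path conG maxT v0 x.
have [m [n [m0 n0 mn]]] := commensurator ET lam0 wl.
by exists m, n; rewrite conjgM (conjgE _ (gexpz _ k0)) gexpz_comm mulKg.
Qed.

Lemma residually_finite_kernel : residually_finite G ->
  forall alpha : G, Phi alpha = 1 -> alpha = 1.
Proof.
move=> rf alpha Pal; apply: contrapT => al1.
have Pal' x : x = alpha -> Phi x = 1 by move->.
have [K [a [b [F [f [al [z [_ [fM _] [f2 ->] nz esc]]]]]]]] :=
  kernel_cover conG maxT PhiM tau0 Phi_vertex Phi_edge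
    (A := fun x => x = alpha) denq_t Pal' erefl al1.
have [m [n [m0 n0 mn]]] := commensurator_v0 t.
have [p [p' [p0 _ pp']]] := commensurator_v0 alpha.
(* [Phi] does not see [alpha] and is injective on the vertex group, so [p = p']. *)
have {pp'} pal : gexpz (gvertex v0) p ^ alpha = gexpz (gvertex v0) p.
  have := congr1 Phi pp'; rewrite (morph_gJ PhiM) Pal conjg1.
  rewrite !(Phi_v0 PhiM tau0 Phi_vertex) => /(congr1 fst) /= /intr_inj e.
  by rewrite pp' -e.
(* Passing to the power [d] makes the exponents coprime; the factor [p] makes [g] commute with
   [alpha]. *)
pose d := gcdz m n; pose m1 := (m %/ d)%Z; pose n1 := (n %/ d)%Z.
have d0 : d != 0%R by rewrite gcdz_eq0 negb_and m0.
have mE : m = (d * m1)%R by rewrite mulrC divzK ?dvdz_gcdl.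
have nE : n = (d * n1)%R by rewrite mulrC divzK ?dvdz_gcdr.
have cop : coprimez m1 n1.
  apply/eqP/(mulfI d0); rewrite mulr1.
  have := mulz_gcdr d m1 n1; rewrite -mE -nE -/d gez0_abs //; exact: gcdz_ge0.
pose g := gexpz (gvertex v0) (d * p).
have gal : g ^ alpha = g by rewrite /g mulrC gexpzM -gexpzJ pal.
have gt : gexpz g m1 ^ t = gexpz g n1.
  rewrite /g -!gexpzM mulrAC -mE mulrAC -nE !gexpzM -gexpzJ mn //.
have [k fk] := esc (d * p)%R (mulf_neq0 d0 p0).
have comm : commute alpha (g ^ (t ^+ k)).
  apply/commgP/eqP; apply: contrapT => /rf[H [h [fH _]]]; apply.
  have hM : {morph h : x y / x * y} by apply: gmulfM.
  have hgt : gexpz (h g) m1 ^ h t = gexpz (h g) n1.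
    by rewrite -!(morph_gexpz hM) -(morph_gJ hM) gt.
  have [j gj] := finite_coprime_conj fH cop hgt.
  have [i gi] : exists i, h g ^ (h t ^+ k) = gexpz (h g) i.
    elim: {fk} k => [|k [i IH]]; first by exists 1%R; rewrite conjg1.
    by exists (j * i)%R; rewrite expgS conjgM gj -gexpzJ IH -!gexpzM mulrC.
  rewrite (morph_gR hM) (morph_gJ hM) (morph_gX hM) gi.
  apply/eqP/commgP/gexpz_commute/commute_sym; apply/commgP; rewrite -conjg_fix.
  by rewrite -(morph_gJ hM) gal.
(* At [z'] the cycle of [alpha] vanishes, and [c] moves [z'] to [z]; comparing the two products
   there gives 0 at [z]. *)
set c := f (g ^ (t ^+ k)) in fk *; set z' := z * c.2^-1 in fk.
have : f alpha * c = c * f alpha by rewrite -!fM comm.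
move=> /(congr1 (fun w : wreath K int => w.1 z')).
rewrite !wreath_fstM fk f2 // mulg1 add0r /z' mulgVK -/z' => e.
by apply: nz; apply: (addrI (c.1 z')); rewrite -e addr0.
Qed.

Lemma solvable_kernel : solvable_group G ->
  forall alpha : G, Phi alpha = 1 -> alpha = 1.
Proof.
move=> /solvable_groupP[n nG] alpha0 Pal0; apply: contrapT => al0.
(* The last nontrivial [A i] is an abelian normal subgroup inside the kernel. *)
pose A i (x : G) := derived_series i x /\ Phi x = 1.
have [i [beta [Ab b1] Ai1]] : exists i, exists2 beta, A i beta /\ beta <> 1
    & forall x, A i.+1 x -> x = 1.
  apply: contrapT => noi.
  have /(_ n)[x [[nx _] x1]] : forall i, exists x, A i x /\ x <> 1.
    elim=> [|i [x [Ax x1]]]; first by exists alpha0.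
    apply: contrapT => nox; apply: noi; exists i; exists x => // y Ay.
    by apply: contrapT => y1; apply: nox; exists y.
  exact/x1/nG.
have AJ x y : A i x -> A i (x ^ y).
  move=> [ix Px]; split; last by rewrite (morph_gJ PhiM) Px conj1g.
  by apply: (@morph_derived_series _ _ (fun x => x ^ y)) => // u v; apply: conjMg.
have AC x y : A i x -> A i y -> commute x y.
  move=> [ix Px] [iy Py]; apply/commgP/eqP/Ai1; split; first exact: derived_seriesR.
  by rewrite (morph_gR PhiM) Px comm1g.
have [K [a [b [F [f [al [z [[ab Ff] [fM fE] [f2 Aal] nz esc]]]]]]]] :=
  kernel_cover conG maxT PhiM tau0 Phi_vertex Phi_edge
    denq_t (fun x (Ax : A i x) => Ax.2) Ab b1.
have [k fk] := esc 1%R isT.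
set g := _ ^ (t ^+ k) in fk; pose al' := al ^ g.
have Aal' : A i al' by apply: AJ.
have fal' w : (f al').1 w = (f al).1 (w * (f g).2^-1).
  by rewrite /al' (morph_gJ fM) wreath_conj //; apply: f2.
pose z1 := z * (f g).2.
have [h [hM hE]] := based_hom maxT v0
  (wreath_rep (wreath_rep ab Ff) (step_edge_function (F := F) z z1 Ff)).
have hsnd x : (h x).2 = f x.
  have [k1 [l1 [wl1 _ ->]]] := reduced_path conG maxT v0 x.
  by rewrite hE // fE // /based_eval sd_gexpz0 /= wreath_eval_snd.
have [k1 [l1 [wl1 _ alE]]] := reduced_path conG maxT v0 al.
have [k2 [l2 [wl2 _ al'E]]] := reduced_path conG maxT v0 al'.
have loc x w w' : w.1 z = w'.1 z -> w.2 = w'.2 -> (h x).1 w = (h x).1 w'.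
  have [k3 [l3 [wl3 _ ->]]] := reduced_path conG maxT v0 x.
  by rewrite hE //; apply: step_local.
have [L1 high] := step_high a b F z z1 v0 k2 l2 1.
have [L2 low] := step_low a b F z z1 v0 k2 l2 1.
rewrite -hE // -fE // -[based_eval gvertex gedge v0 k2 l2]al'E in high.
rewrite -hE // -[based_eval gvertex gedge v0 k2 l2]al'E in low.
pose D := (f al).1 z.
pose sheet (I : int) : wreath K int := ((fun=> I), 1).
(* [al] moves the sheet by [D] and [al'] by [(f al).1] at the escaped point, which is 0; commutation
   then compares the values of [al'] on both sheets. *)
have period I : (h al').1 (sheet (I + D)%R) = (h al').1 (sheet I).
  have comm : h al * h al' = h al' * h al by rewrite -!hM AC.
  have := congr1 (fun x : wreath (wreath K int) int => x.1 (sheet I)) comm.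
  rewrite !wreath_fstM !hsnd (loc al (sheet I * f al') (sheet I)); first last.
  - by rewrite /= f2 // mulg1.
  - by rewrite wreath_fstM mulg1 fal' fk addr0.
  rewrite addrC => /addIr <-; apply: loc; last by rewrite /= f2 // mulg1.
  by rewrite wreath_fstM mulg1.
have periodn I (j : nat) : (h al').1 (sheet (I + D *+ j)%R) = (h al').1 (sheet I).
  by elim: j => [|j IH]; rewrite ?addr0 // mulrSr addrA period IH.
(* Since [D] is nonzero, a multiple of it leads from the high sheet [L1] to one below [L2]. *)
have [J J2 JE] : exists2 J, (J <= L2)%R & (h al').1 (sheet J) = (h al').1 (sheet L1).
  have Dn0 : D != 0%R by apply/eqP.
  pose j := `|L1 - L2|%N; have [D0|D0] : (0 < D \/ D < 0)%R.
  - by case: (ltgtP 0%R D) Dn0 => //; auto.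
  - exists (L1 - D *+ j)%R; last by rewrite -(periodn (L1 - D *+ j)%R j) addrNK.
    by rewrite -mulr_natr natz /j; nia.
  - exists (L1 + D *+ j)%R; last exact: periodn.
    by rewrite -mulr_natr natz /j; nia.
(* On [L1] the value is that of [al'] at [z1], i.e. of [al] at [z]; on [J] it is 0. *)
apply: nz; rewrite -(mulgK (f g).2 z) -/z1 -fal' -[z1]mulg1.
by rewrite -(high (sheet L1)) // -JE low.
Qed.

End KernelTrivial.

Lemma residually_weaken (C D : groupType -> Prop) (G : groupType) :
  (forall H, C H -> D H) -> residually C G -> residually D G.
Proof. by move=> CD rG g /rG[H [f [/CD DH fs fg]]]; exists H, f. Qed.

Lemma rat_unit_int (q : rat) : q != 0%R -> denq q = 1%R -> denq q^-1%R = 1%R ->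
  q = 1%R \/ q = (-1)%R.
Proof.
move=> q0 dq dqV; have qE : q = (numq q)%:~R%R by rewrite -{1}(divq_num_den q) dq divr1.
have qVE : q^-1%R = (numq q^-1)%:~R%R by rewrite -{1}(divq_num_den q^-1) dqV divr1.
have : (`|numq q| * `|numq q^-1%R| == 1)%N.
  rewrite -abszM (_ : _ * _ = 1)%R //; apply: (@intr_inj rat).
  by rewrite intrM -qE -qVE mulfV.
rewrite muln_eq1 => /andP[/eqP n1 _]; rewrite qE.
by case: (numq q) n1 => -[|[|n]] //= _; [left|right].
Qed.

Theorem corollary1 (Gamma : graph)
    (Gamma_nonempty : (0 < #|vertex Gamma|)%N)
    (Gamma_connected : connected_graph Gamma)
    (lam : bool -> edge Gamma -> int)
    (lam_neq0 : forall s e, lam s e != 0%R)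
    (VT : {set vertex Gamma}) (ET : {set edge Gamma})
    (T_maximal : maximal_subtree VT ET) :
  let G := gbs_group lam ET in
  (residually_finite G <-> residually_finite_solvable G) /\
  (residually_finite G <->
     solvable_group G \/
     (~ solvable_group G /\
      (range (@Delta Gamma lam ET) `<=` [set 1%R; (-1)%R])%classic)).
Proof.
move=> G; have /card_gt0P[v0 _] := Gamma_nonempty.
have [Phi [tau [PhiM tau0 Phi_vertex Phi_edge]]] :=
  rep_hom T_maximal v0 (affine_rep (lam_rat lam_neq0)).
have DE := DeltaE Gamma_connected T_maximal lam_neq0 v0 PhiM Phi_vertex.
pose unimodular := forall x : G, val (Phi x).2 = 1%R \/ val (Phi x).2 = (-1)%R.
have uniP : (range (@Delta Gamma lam ET) `<=` [set 1%R; (-1)%R])%classic <-> unimodular.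
  split=> [uni x | uni _ [x _ <-]].
    have := uni _ (imageP (@Delta Gamma lam ET) (I : [set: G]%classic x)).
    by rewrite DE => -[] /(congr1 GRing.inv); rewrite invrK => ->;
       rewrite ?invrN invr1; [left|right].
  by rewrite DE; case: (uni x) => ->; rewrite ?invrN invr1; [left|right].
have toRF : residually_finite_solvable G -> residually_finite G.
  by apply: residually_weaken => H [].
have uniRFS : unimodular -> residually_finite_solvable G.
  move=> uni; apply: residually_finite_solvableP.
  exact: (unimodular_separated Gamma_connected T_maximal v0 Phi_edge uni).
have injRFS : (forall x, Phi x = 1 -> x = 1) -> residually_finite_solvable G.
  move=> Phi_inj; apply: residually_finite_solvableP => x x1.
  have [k0 [l [wl _ xE]]] := reduced_path Gamma_connected T_maximal v0 x.
  rewrite xE; apply: (affine_separated T_maximal wl).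
  rewrite -(Phi_based PhiM tau0 Phi_vertex Phi_edge k0 wl) => /Phi_inj e.
  by apply: x1; rewrite xE.
have injS : (forall x, Phi x = 1 -> x = 1) -> solvable_group G.
  by move=> Phi_inj; apply: (solvable_inj PhiM Phi_inj); apply: affine_solvable.
(* In the unimodular case the residual properties hold outright; otherwise they and solvability all
   amount to injectivity of [Phi]. *)
have [uni|nuni] := pselect unimodular.
  split; first by split=> [_|]; [apply: uniRFS | apply: toRF].
  split=> [_|_]; last exact/toRF/uniRFS.
  by have [sG|nsG] := pselect (solvable_group G);
    [left | right; split=> //; apply/uniP].
(* A rational that is integral together with its inverse is 1 or -1, so some element or its inverse
   has a proper denominator. *)
have [t denq_t] : exists t : G, denq (val (Phi t).2)^-1%R <> 1%R.
  apply: contrapT => noT; apply: nuni => x.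
  apply: rat_unit_int; first exact: units_neq0.
    apply: contrapT => d; apply: noT; exists x^-1.
    by rewrite (morph_gV PhiM) /= invrK.
  by apply: contrapT => d; apply: noT; exists x.
have rfI := residually_finite_kernel Gamma_connected T_maximal PhiM tau0 Phi_vertex
  Phi_edge denq_t.
have sI := solvable_kernel Gamma_connected T_maximal PhiM tau0 Phi_vertex
  Phi_edge denq_t.
split; first by split=> [/rfI/injRFS|/toRF].
split=> [/rfI/injS|[/sI/injRFS/toRF //|[_ /uniP //]]]; by left.
Qed.
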